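(* Let $\mathcal H=\mathcal H_1\oplus\cdots\oplus\mathcal H_N$ be the direct Hilbert sum of real Hilbert spaces $\mathcal H_1,\dots,\mathcal H_N$, let $\texttt{F}_i:\mathcal H\to\mathcal H_i$ for $i=1,\dots,N$, and let $F=(\texttt{F}_1,\dots,\texttt{F}_N):\mathcal H\to\mathcal H$, $F(x)=(\texttt{F}_1(x),\dots,\texttt{F}_N(x))$. Assume: (i) $\mathcal G$ is a strongly connected directed graph on $\{1,\dots,N\}$ and $A=(a_{ij})$ is a row-stochastic $N\times N$ matrix consistent with $\mathcal G$ with $a_{ii}>0$ for all $i$ (see context); (ii) for each $i$ there is $L_i>0$ with $\|\texttt{F}_i(x)-\texttt{F}_i(y)\|\le L_i\|x-y\|$ for all $x,y\in\mathcal H$; (iii) $F$ is quasi-nonexpansive with $Fix(F)\ne\emptyset$, and there is a constant $\kappa>0$ such that $d_{Fix(F)}(x)\le\kappa\|F(x)-x\|$ for all $x\in\mathcal H$. Let $\delta\in(0,1)$ be any pre-specified parameter and suppose the stepsize $\alpha$ satisfies $$0<\alpha<\min\{1-\delta,\alpha_L\},$$ where $\alpha_L$ is the smallest positive real root of the equation $\det(I-\Theta(\alpha))=0$, with $$\Theta(\alpha):=\begin{pmatrix}\rho_1+\alpha\theta_5 & 2\alpha c_2\sqrt{2\varpi}\\ \frac{\alpha(\bar L+1)}{c_1} & 1-\frac{\delta\alpha}{4\kappa^2}\end{pmatrix},$$ $\theta_5:=2c_2\sqrt{\varpi(\bar L^2+1)}/c_1$, $\bar L:=\max_i L_i$, $\varpi:=N-1+\frac{(1-\underline\pi)^2}{\underline\pi^2}$,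 $\underline\pi:=\min_i\pi_i>0$ (the quantities $\pi,\rho_1,c_1,c_2$ are defined in the context). Then all the sequences $(x_k^i)_{k\ge0}$ in $\mathcal H$, $i=1,\dots,N$, generated by the DOP algorithm (see context), for arbitrary initial points $x_0^i\in\mathcal H$, converge to a common point in $Fix(F)$ at a linear rate.
   Context: Operators: $Fix(T)=\{x:T(x)=x\}$. $T$ is quasi-nonexpansive if $\|T(x)-y\|\le\|x-y\|$ for all $x\in\mathcal H$, $y\in Fix(T)$. $d_X(z)=\inf_{x\in X}\|z-x\|$. The norm on $\mathcal H$ satisfies $\|(x_1,\dots,x_N)\|^2=\sum_i\|x_i\|^2$. Graph and matrix: $\mathcal G=(\{1,\dots,N\},\mathcal E)$ is a simple directed graph, an edge $(i,j)\in\mathcal E$ meaning that $i$ can send information to $j$; strongly connected means any node can be reached from any other by a directed path. $A$ is nonnegative; consistency with $\mathcal G$ means that for $i\ne j$, $a_{ij}>0$ iff $(j,i)\in\mathcal E$. Let $\pi=(\pi_1,\dots,\pi_N)^\top$ be the stochastic (entries summing to $1$) vector with $\pi^\top A=\pi^\top$; then $\pi_i>0$ and $A_\infty:=\lim_kA^k=\mathbf 1_N\pi^\top$. DOP algorithm: each agent $i$ keeps $x_k^i=(x_{1,k}^i,\dots,x_{N,k}^i)\in\mathcal H$ with $x_{j,k}^i\in\mathcal H_j$; write $x_{i,k}:=x_{i,k}^i$ and $x_{-i,k}^j:=(x_{1,k}^j,\dots,x_{i-1,k}^j,x_{i+1,k}^j,\dots,x_{N,k}^j)$. Starting from arbitrary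 $x_0^i\in\mathcal H$, for $k\ge0$ and each $i$ $$x_{i,k+1}=\sum_{j=1}^N a_{ij}x_{i,k}^j+\frac{\alpha}{\pi_i}\Big(\texttt{F}_i(x_k^i)-\sum_{j=1}^Na_{ij}x_{i,k}^j\Big),\qquad x_{-i,k+1}^i=\sum_{j=1}^Na_{ij}x_{-i,k}^j.$$ Norms: for $z=(z_1,\dots,z_N)$ in $\mathcal H^N$ (or in $\mathbb R^N$, with absolute values), $\|z\|=\sqrt{\sum_i\|z_i\|^2}$ and $\|z\|_\pi=\sqrt{\sum_i\pi_i\|z_i\|^2}$; for $N\times N$ real matrices $\|\cdot\|,\|\cdot\|_\pi$ denote the norms induced by the corresponding norms on $\mathbb R^N$. $\rho_1:=\|A-A_\infty\|_\pi$ (known to be $<1$). $c_1,c_2>0$ are constants such that $c_1\|\cdot\|\le\|\cdot\|_\pi\le c_2\|\cdot\|$ holds for these vector norms (on $\mathcal H^N$ and $\mathbb R^N$) and for the induced matrix norms. Convergence of all $x_k^i$ to a common point at a linear rate means: there are $x^*\in Fix(F)$, $C>0$ and $r\in(0,1)$ with $\|x_k^i-x^*\|\le Cr^k$ for all $i$ and all $k\ge0$. *)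

(* Defs.v *)
From HB Require Import structures.
From mathcomp Require Import all_boot all_order all_algebra.
From mathcomp Require Import sesquilinear.
From mathcomp Require Import mathcomp_extra boolp classical_sets functions.
From mathcomp Require Import reals ereal topology normedtype sequences.

Set Implicit Arguments.
Unset Strict Implicit.
Unset Printing Implicit Defensive.

Import Order.TTheory GRing.Theory Num.Theory.
Import numFieldNormedType.Exports.

Local Open Scope classical_set_scope.
Local Open Scope ring_scope.

(* A real Hilbert space: a complete normed space whose norm is induced by an
   inner product (a symmetric, positive definite bilinear form). *)
HB.mixin Record isHilbert (R : realType) V of CompleteNormedModule R V := {
  inner : {dot V for (@idfun R)} ;
  sqr_norm_inner : forall x : V, `|x| ^+ 2 = inner x x }.

#[short(type="hilbertType")]
HB.structure Definition Hilbert (R : realType) :=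
  {V of isHilbert R V & CompleteNormedModule R V}.

Section WeightedNorms.
Context {R : realType} {N : nat}.
Implicit Types (a : 'I_N -> R) (p : 'cV[R]_N) (M : 'M[R]_N).

Definition l2 a : R := Num.sqrt (\sum_i a i ^+ 2).

Definition wl2 p a : R := Num.sqrt (\sum_i p i 0 * a i ^+ 2).

Definition vnorm (z : 'cV[R]_N) : R := l2 (fun i => `|z i 0|).

Definition vnorm_w p (z : 'cV[R]_N) : R := wl2 p (fun i => `|z i 0|).

Definition induced_norm (nrm : 'cV[R]_N -> R) M : R :=
  sup [set nrm (M *m z) | z in [set z | nrm z <= 1]].

Definition mnorm M : R := induced_norm vnorm M.

Definition mnorm_w p M : R := induced_norm (vnorm_w p) M.

End WeightedNorms.

(* The direct Hilbert sum of the H i: a finite family, so all of the product.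
   Only its group structure and its norm [dnorm] are needed. *)
Definition dsum {R : realType} {N : nat} (H : 'I_N -> hilbertType R) : Type :=
  forall i, H i.

Section DirectSum.
Context {R : realType} {N : nat} (H : 'I_N -> hilbertType R).

HB.instance Definition _ := gen_eqMixin (dsum H).
HB.instance Definition _ := gen_choiceMixin (dsum H).

Definition dsum_zero : dsum H := fun=> 0.
Definition dsum_opp (x : dsum H) : dsum H := fun i => - x i.
Definition dsum_add (x y : dsum H) : dsum H := fun i => x i + y i.

Fact dsum_addA : associative dsum_add.
Proof. by move=> x y z; apply: functional_extensionality_dep => i; exact: addrA. Qed.
Fact dsum_addC : commutative dsum_add.
Proof. by move=> x y; apply: functional_extensionality_dep => i; exact: addrC. Qed.
Fact dsum_add0 : left_id dsum_zero dsum_add.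
Proof. by move=> x; apply: functional_extensionality_dep => i; exact: add0r. Qed.
Fact dsum_addN : left_inverse dsum_zero dsum_opp dsum_add.
Proof. by move=> x; apply: functional_extensionality_dep => i; exact: addNr. Qed.

HB.instance Definition _ := GRing.isZmodule.Build (dsum H)
  dsum_addA dsum_addC dsum_add0 dsum_addN.

Definition dnorm (x : dsum H) : R := l2 (fun i => `|x i|).

Definition nnorm (z : 'I_N -> dsum H) : R := l2 (fun i => dnorm (z i)).

Definition nnorm_w (p : 'cV[R]_N) (z : 'I_N -> dsum H) : R :=
  wl2 p (fun i => dnorm (z i)).

Definition joint (Fi : forall i : 'I_N, dsum H -> H i) : dsum H -> dsum H :=
  fun x i => Fi i x.

Definition Fix (T : dsum H -> dsum H) : set (dsum H) := [set x | T x = x].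

Definition quasi_nonexpansive (T : dsum H -> dsum H) : Prop :=
  forall x y, Fix T y -> dnorm (T x - y) <= dnorm (x - y).

Definition distance (X : set (dsum H)) (z : dsum H) : R :=
  inf [set dnorm (z - x) | x in X].

(* [x k i j] is the block x_{j,k}^i in H_j of agent i's estimate at time k;
   the initial estimates [x 0 i] are unconstrained. *)
Definition dop_iterates (A : 'M[R]_N) (p : 'cV[R]_N) (alpha : R)
    (Fi : forall i : 'I_N, dsum H -> H i) (x : nat -> 'I_N -> dsum H) : Prop :=
  forall (k : nat) (i : 'I_N),
    x k.+1 i i = \sum_j A i j *: x k j i
      + (alpha / p i 0) *: (Fi i (x k i) - \sum_j A i j *: x k j i)
    /\ forall l : 'I_N, l != i -> x k.+1 i l = \sum_j A i j *: x k j l.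

Definition norm_equiv_constants (p : 'cV[R]_N) (c1 c2 : R) : Prop :=
  [/\ forall z : 'I_N -> dsum H, c1 * nnorm z <= nnorm_w p z <= c2 * nnorm z,
      forall z : 'cV[R]_N, c1 * vnorm z <= vnorm_w p z <= c2 * vnorm z &
      forall M : 'M[R]_N, c1 * mnorm M <= mnorm_w p M <= c2 * mnorm M].

End DirectSum.

Section NetworkAndConstants.
Context {R : realType} {N : nat}.
Implicit Types (A : 'M[R]_N) (p : 'cV[R]_N) (g : rel 'I_N).

(* [g i j] means that i can send information to j. *)
Definition strongly_connected g : Prop := forall i j, connect g i j.

Definition row_stochastic A : Prop :=
  (forall i j, 0 <= A i j) /\ (forall i, \sum_j A i j = 1).

(* Entry (i, j) of A weights what i receives from j, hence the edge (j, i). *)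
Definition consistent g A : Prop := forall i j, i != j -> (0 < A i j) = g j i.

Definition stochastic_vector p : Prop :=
  (forall i, 0 <= p i 0) /\ \sum_i p i 0 = 1.

Definition Ainfty A : 'M[R]_N := lim ((fun k => A ^+ k) @ \oo).

Definition rho1 A p : R := mnorm_w p (A - Ainfty A).

(* The default values 1 and 0 are inert: entries of a stochastic vector are at
   most 1, Lipschitz constants are positive, and N > 0 if the entries of p sum
   to 1. *)
Definition pmin p : R := \big[Num.min/1]_(i < N) p i 0.

Definition Lbar (L : 'I_N -> R) : R := \big[Num.max/0]_(i < N) L i.

Definition varpi p : R := N%:R - 1 + (1 - pmin p) ^+ 2 / pmin p ^+ 2.

Definition theta5 p (L : 'I_N -> R) (c1 c2 : R) : R :=
  2 * c2 * Num.sqrt (varpi p * (Lbar L ^+ 2 + 1)) / c1.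

Definition Theta A p (L : 'I_N -> R) (c1 c2 kappa delta alpha : R) : 'M[R]_2 :=
  \matrix_(i, j) nth 0 (nth [::]
    [:: [:: rho1 A p + alpha * theta5 p L c1 c2;
            2 * alpha * c2 * Num.sqrt (2 * varpi p)];
        [:: alpha * (Lbar L + 1) / c1;
            1 - delta * alpha / (4 * kappa ^+ 2)]] i) j.

End NetworkAndConstants.

(* [a] is the smallest positive root of f, with the convention a = +oo when f
   has no positive root: this happens for det (I - Theta) when N = 1. *)
Definition smallest_positive_root {R : realType} (f : R -> R) (a : \bar R) :
    Prop :=
  match a with
  | r%:E => [/\ 0 < r, f r = 0 & forall s, 0 < s -> f s = 0 -> r <= s]
  | +oo%E => forall s, 0 < s -> f s <> 0
  | -oo%E => False
  end.

(* Main.v *)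
(** Write [xbar] for the [p]-average of the agents' estimates and [E] for their
    deviations from it. One step of the algorithm reads
    [xbar' = xbar + alpha * g], where [g] is [F xbar - xbar] up to an error
    controlled by [E], and [E' = ((A - Ainfty) (x) id) E + alpha * (spread of g)].
    Quasi-nonexpansiveness and regularity make the relaxed step
    [xbar + alpha * (F xbar - xbar)] shrink the distance to [Fix F], so the pair
    ([nnorm_w p E], distance of [xbar] to [Fix F]) is dominated by iterating
    [Theta alpha]. Since [det (I - Theta)] is [alpha] times an affine decreasing
    function that is positive at [0], it is positive below its first positive
    root, and a weighted sum of the two quantities then contracts. Hence [xbar]
    has geometrically decreasing increments, and its limit is fixed by [F].

    That [rho1 < 1] follows without compactness: the energy lost by averaging
    with [A] is a weighted sum of variances, which controls differences along
    edges, hence along paths, hence all of the energy of a centered vector. The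
    bound by [rho1], a norm on real matrices, passes to vectors with blocks in
    [H l] because a positive semidefinite form stays positive when its scalar
    variables are replaced by vectors of an inner product space. *)

Require Import Defs.
From HB Require Import structures.
From mathcomp Require Import all_boot all_order all_algebra.
From mathcomp Require Import sesquilinear.
From mathcomp Require Import mathcomp_extra boolp classical_sets functions.
From mathcomp Require Import reals ereal topology normedtype sequences.
From mathcomp Require Import ring lra.

Set Implicit Arguments.
Unset Strict Implicit.
Unset Printing Implicit Defensive.

Import Order.TTheory GRing.Theory Num.Theory.
Import numFieldNormedType.Exports.

Local Open Scope classical_set_scope.
Local Open Scope ring_scope.

(** * Weighted Euclidean sums *)

Section WeightedSums.
Context {R : realType}.

(** Expanding the sum of [w i * (T * a i - U * b i) ^+ 2] gives [T * (S * T - U ^+ 2)], which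
    settles [T > 0]; if [T = 0], every [w i * b i] vanishes and so does [U]. *)
Lemma weighted_cauchy_schwarz (I : finType) (w a b : I -> R) :
    (forall i, 0 <= w i) ->
  (\sum_i w i * (a i * b i)) ^+ 2 <=
    (\sum_i w i * a i ^+ 2) * (\sum_i w i * b i ^+ 2).
Proof.
move=> w0; set U := \sum_i _; set S := \sum_i _; set T := \sum_i _.
have T0 : 0 <= T by apply: sumr_ge0 => i _; rewrite mulr_ge0 ?sqr_ge0.
have [Tgt|Tle] := ltP 0 T; last first.
  have /eqP : T = 0 by apply: le_anti; rewrite Tle T0.
  rewrite psumr_eq0 => [/allP T_eq0|i _]; last by rewrite mulr_ge0 ?sqr_ge0.
  suff -> : U = 0.
    rewrite expr0n mulr_ge0 // sumr_ge0 // => i _.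
    by rewrite mulr_ge0 ?sqr_ge0.
  apply: big1 => i _; have := T_eq0 i (mem_index_enum i).
  rewrite implyTb mulf_eq0 expf_eq0 /= => /orP[|] /eqP ->; first by rewrite mul0r.
  by rewrite !mulr0.
have : 0 <= \sum_i w i * (T * a i - U * b i) ^+ 2.
  by apply: sumr_ge0 => i _; rewrite mulr_ge0 ?sqr_ge0.
rewrite (_ : \sum_i _ = T * (S * T - U ^+ 2)) ?pmulr_rge0 ?subr_ge0 //.
transitivity (T ^+ 2 * S - 2 * T * U * U + U ^+ 2 * T); last by ring.
transitivity (\sum_i T ^+ 2 * (w i * a i ^+ 2)
  - \sum_i 2 * T * U * (w i * (a i * b i)) + \sum_i U ^+ 2 * (w i * b i ^+ 2)).
  by rewrite -sumrB -big_split /=; apply: eq_bigr => i _; ring.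
by rewrite -!mulr_sumr.
Qed.

(* Cauchy-Schwarz against the constant 1. *)
Lemma sqr_mean_le (I : finType) (w a : I -> R) :
    (forall i, 0 <= w i) -> \sum_i w i = 1 ->
  (\sum_i w i * a i) ^+ 2 <= \sum_i w i * a i ^+ 2.
Proof.
move=> w0 w1; have := weighted_cauchy_schwarz a (fun=> 1) w0.
by under eq_bigr do rewrite mulr1; under [X in _ * X]eq_bigr do
  rewrite expr1n mulr1; rewrite w1 mulr1.
Qed.

Context {N : nat}.
Implicit Types (p : 'cV[R]_N) (a b : 'I_N -> R).

Lemma l2_wl2 a : l2 a = wl2 (const_mx 1) a.
Proof. by congr Num.sqrt; apply: eq_bigr => i _; rewrite mxE mul1r. Qed.

Lemma wl2_ge0 p a : 0 <= wl2 p a.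
Proof. exact: sqrtr_ge0. Qed.

Lemma l2_ge0 a : 0 <= l2 a.
Proof. exact: sqrtr_ge0. Qed.

Lemma sqr_wl2 p a : (forall i, 0 <= p i 0) ->
  wl2 p a ^+ 2 = \sum_i p i 0 * a i ^+ 2.
Proof.
by move=> p0; rewrite sqr_sqrtr // sumr_ge0 // => i _; rewrite mulr_ge0 ?sqr_ge0.
Qed.

Lemma sqr_l2 a : l2 a ^+ 2 = \sum_i a i ^+ 2.
Proof. by rewrite sqr_sqrtr // sumr_ge0 // => i _; rewrite sqr_ge0. Qed.

Lemma wl2_le p a b : (forall i, 0 <= p i 0) -> (forall i, 0 <= a i <= b i) ->
  wl2 p a <= wl2 p b.
Proof.
move=> p0 ab; rewrite ler_wsqrtr // ler_sum // => i _.
by have /andP[a0 le_ab] := ab i; rewrite ler_wpM2l // lerXn2r ?nnegrE // (le_trans a0).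
Qed.

Lemma wl2D p a b : (forall i, 0 <= p i 0) ->
  wl2 p (fun i => a i + b i) <= wl2 p a + wl2 p b.
Proof.
move=> p0; rewrite -(@ler_pXn2r _ 2) ?nnegrE ?addr_ge0 ?wl2_ge0 //.
rewrite sqrrD !sqr_wl2 //.
have le_ab : \sum_i p i 0 * (a i * b i) <= wl2 p a * wl2 p b.
  apply: le_trans (ler_norm _) _.
  rewrite -(@ler_pXn2r _ 2) ?nnegrE ?mulr_ge0 ?wl2_ge0 ?normr_ge0 //.
  rewrite real_normK ?num_real // exprMn !sqr_wl2 //.
  exact: weighted_cauchy_schwarz.
rewrite [leLHS](_ : _ = \sum_i p i 0 * a i ^+ 2 + (\sum_i p i 0 * (a i * b i)) *+ 2
  + \sum_i p i 0 * b i ^+ 2); first by rewrite lerD2r lerD2l lerMn2r le_ab orbT.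
rewrite -sumrMnl -!big_split /=; apply: eq_bigr => i _; ring.
Qed.

Lemma wl2Z p a c : 0 <= c -> wl2 p (fun i => c * a i) = c * wl2 p a.
Proof.
move=> c0; rewrite /wl2 -{2}(ger0_norm c0) -sqrtr_sqr -sqrtrM ?sqr_ge0 //.
by congr Num.sqrt; rewrite mulr_sumr; apply: eq_bigr => i _; ring.
Qed.

Let const1_ge0 i : 0 <= (const_mx 1 : 'cV[R]_N) i 0.
Proof. by rewrite mxE ler01. Qed.

Lemma l2_le a b : (forall i, 0 <= a i <= b i) -> l2 a <= l2 b.
Proof. by move=> ab; rewrite !l2_wl2 wl2_le. Qed.

Lemma l2D a b : l2 (fun i => a i + b i) <= l2 a + l2 b.
Proof. by rewrite !l2_wl2 wl2D. Qed.

Lemma l2Z a c : 0 <= c -> l2 (fun i => c * a i) = c * l2 a.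
Proof. by move=> c0; rewrite !l2_wl2 wl2Z. Qed.

Lemma ler_l2 a i : 0 <= a i -> a i <= l2 a.
Proof.
move=> a0; rewrite -(@ler_pXn2r _ 2) ?nnegrE ?l2_ge0 // sqr_l2 (bigD1 i) //=.
by rewrite lerDl sumr_ge0 // => j _; rewrite sqr_ge0.
Qed.

End WeightedSums.

(** * Averaging with a stochastic matrix *)

Section Consensus.
Context {R : realType} {N : nat} (g : rel 'I_N) (A : 'M[R]_N) (p : 'cV[R]_N).
Hypotheses (g_connected : strongly_connected g) (A_stochastic : row_stochastic A)
  (A_consistent : consistent g A) (A_diag : forall i, 0 < A i i)
  (p_stochastic : stochastic_vector p) (p_invariant : p^T *m A = p^T).

Implicit Types z : 'cV[R]_N.

Let A_ge0 i j : 0 <= A i j. Proof. by case: A_stochastic. Qed.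
Let A_sum1 i : \sum_j A i j = 1. Proof. by case: A_stochastic. Qed.
Let p_ge0 i : 0 <= p i 0. Proof. by case: p_stochastic. Qed.
Let p_sum1 : \sum_i p i 0 = 1. Proof. by case: p_stochastic. Qed.

Lemma invariant_sum j : \sum_i p i 0 * A i j = p j 0.
Proof.
have /matrixP/(_ 0 j) := p_invariant; rewrite !mxE => <-.
by apply: eq_bigr => i _; rewrite mxE.
Qed.

(** A zero of [p] spreads along edges: if [p i 0 = 0], invariance at [i] is a vanishing sum of
    nonnegative terms [p k 0 * A k i], and [A k i > 0] on an edge from [i] to [k]. By connectedness
    all of [p] would vanish, yet its entries sum to 1. *)
Lemma invariant_gt0 i : 0 < p i 0.
Proof.
rewrite lt0r p_ge0 andbT; apply/eqP => pi0.
suff p0 j : p j 0 = 0.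
  by have := @oner_neq0 R; rewrite -p_sum1 big1 ?eqxx.
have /connectP[s g_s ->] := g_connected i j.
elim: s i g_s pi0 => [|k s IHs] i //= /andP[g_ik g_s] pi0; apply: IHs => //.
apply/eqP; apply/negPn/negP => pk0.
have [ki|ki] := eqVneq k i; first by rewrite ki pi0 eqxx in pk0.
have := invariant_sum i; rewrite pi0 => /eqP.
rewrite psumr_eq0 => [|l _]; last by rewrite mulr_ge0.
move=> /allP/(_ k (mem_index_enum k)); rewrite implyTb mulf_eq0 (negPf pk0) /=.
by rewrite gt_eqF // A_consistent.
Qed.

(** The [p]-average of the variances of [z] under the rows of [A]; it is the energy lost in one
    averaging step. *)
Let dispersion (z : 'cV[R]_N) : R :=
  \sum_i p i 0 * \sum_j A i j * (z j 0 - (A *m z) i 0) ^+ 2.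

Lemma dispersion_ge0 z : 0 <= dispersion z.
Proof.
apply: sumr_ge0 => i _; rewrite mulr_ge0 // sumr_ge0 // => j _.
by rewrite mulr_ge0 ?sqr_ge0.
Qed.

(** In each row the second moment is the squared mean plus the variance; invariance of [p] then sums
    the second moments. *)
Lemma sqr_norm_mulmx z :
  \sum_i p i 0 * (A *m z) i 0 ^+ 2 + dispersion z = \sum_j p j 0 * z j 0 ^+ 2.
Proof.
transitivity (\sum_i \sum_j p i 0 * A i j * z j 0 ^+ 2); last first.
  rewrite exchange_big /=; apply: eq_bigr => j _.
  by rewrite -mulr_suml invariant_sum.
rewrite -big_split /=; apply: eq_bigr => i _; rewrite -mulrDr.
under [RHS]eq_bigr do rewrite -mulrA; rewrite -mulr_sumr; congr (_ * _).
have Az : \sum_j A i j * z j 0 = (A *m z) i 0 by rewrite mxE.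
set m := (A *m z) i 0 in Az *.
transitivity (m ^+ 2 + (\sum_j A i j * z j 0 ^+ 2
  - 2 * m * (\sum_j A i j * z j 0) + m ^+ 2 * \sum_j A i j)).
  congr (_ + _); rewrite !mulr_sumr -sumrB -big_split /=.
  by apply: eq_bigr => j _; ring.
by rewrite Az A_sum1; ring.
Qed.

Lemma dispersion_term i j z :
  p i 0 * (A i j * (z j 0 - (A *m z) i 0) ^+ 2) <= dispersion z.
Proof.
rewrite /dispersion (bigD1 i) //= -[leLHS]addr0 lerD //.
  rewrite ler_wpM2l // (bigD1 j) //= lerDl sumr_ge0 // => l _.
  by rewrite mulr_ge0 ?sqr_ge0.
rewrite sumr_ge0 // => k _; rewrite mulr_ge0 // sumr_ge0 // => l _.
by rewrite mulr_ge0 ?sqr_ge0.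
Qed.

(** Row [i] gives positive weight to both [i] and [j], so its variance controls the distance of
    [z i 0] and of [z j 0] to the common mean [m]. *)
Lemma sqr_edge_le i j z : 0 < A i j ->
  (z i 0 - z j 0) ^+ 2 <= (2 / (p i 0 * A i i) + 2 / (p i 0 * A i j)) * dispersion z.
Proof.
move=> Aij; have pi0 := invariant_gt0 i.
have step k : 0 < A i k ->
    (z k 0 - (A *m z) i 0) ^+ 2 <= (p i 0 * A i k)^-1 * dispersion z.
  move=> Aik; rewrite mulrC ler_pdivlMr ?mulr_gt0 // mulrC -mulrA.
  exact: dispersion_term.
have := step i (A_diag i); have := step j Aij.
set D := dispersion z; set m := (A *m z) i 0; set u := _^-1 * D; set v := _^-1 * D.
move=> hu hv; rewrite (_ : _ * D = 2 * v + 2 * u); last by rewrite /u /v; ring.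
have := sqr_ge0 (z i 0 + z j 0 - 2 * m); nra.
Qed.

Lemma sqr_path_le i j : exists2 K : R, 0 <= K &
  forall z, (z i 0 - z j 0) ^+ 2 <= K * dispersion z.
Proof.
have /connectP[s] := g_connected j i.
elim: s j => [|k s IHs] j /=.
  by move=> _ <-; exists 0 => // z; rewrite subrr expr0n mul0r.
case/andP=> g_jk /IHs{}IHs /IHs[K K0 KP].
(* Consistency constrains off-diagonal entries only, so a loop in the path is skipped. *)
have [<-|kj] := eqVneq k j; first by exists K.
have Akj : 0 < A k j by rewrite A_consistent.
have pk0 := invariant_gt0 k; have Akk := A_diag k.
pose K' := 2 / (p k 0 * A k k) + 2 / (p k 0 * A k j).
exists (2 * K + 2 * K') => [|z].
  by rewrite addr_ge0 ?mulr_ge0 // /K' addr_ge0 ?divr_ge0 ?mulr_ge0.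
have := KP z; have := sqr_edge_le z Akj; rewrite -/K'.
set D := dispersion z => h1 h2.
rewrite [leRHS](_ : _ = 2 * (K * D) + 2 * (K' * D)); last by ring.
have := sqr_ge0 (z i 0 - 2 * z k 0 + z j 0); nra.
Qed.

(** A Poincaré inequality: an entry of a centered [z] is the [p]-average of its differences with the
    other entries, each of which is controlled along a path. *)
Lemma dispersion_gap : exists2 K : R, 1 <= K &
  forall z, \sum_i p i 0 * z i 0 = 0 ->
    \sum_i p i 0 * z i 0 ^+ 2 <= K * dispersion z.
Proof.
have ex ij : exists K : R, 0 <= K /\
    forall z, (z ij.1 0 - z ij.2 0) ^+ 2 <= K * dispersion z.
  by have [K] := sqr_path_le ij.1 ij.2; exists K.
have [K KP] := choice ex.
(* This dominates every [K ij]; the summand 1 makes [1 - K'^-1] a nonnegative contraction factor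
   later. *)
pose K' := 1 + \sum_ij K ij.
have K0 ij : 0 <= K ij by case: (KP ij).
exists K'; first by rewrite lerDl sumr_ge0.
move=> z z0; have D0 := dispersion_ge0 z.
have le_K i j : (z i 0 - z j 0) ^+ 2 <= K' * dispersion z.
  have [_ /(_ z)/= h] := KP (i, j); apply: le_trans h _; rewrite ler_wpM2r //.
  by rewrite /K' (bigD1 (i, j)) //= addrCA lerDl addr_ge0 // sumr_ge0.
rewrite -[leRHS]mul1r -p_sum1 mulr_suml ler_sum // => i _; rewrite ler_wpM2l //.
have -> : z i 0 = \sum_j p j 0 * (z i 0 - z j 0).
  under eq_bigr do rewrite mulrBr; rewrite sumrB z0 subr0 -mulr_suml p_sum1.
  by rewrite mul1r.
apply: le_trans (sqr_mean_le _ p_ge0 p_sum1) _.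
by rewrite -[leRHS]mul1r -p_sum1 mulr_suml ler_sum // => j _; rewrite ler_wpM2l.
Qed.

Lemma mulmx_contracting : exists2 gam : R, 0 <= gam < 1 &
  forall z, \sum_i p i 0 * z i 0 = 0 ->
    \sum_i p i 0 * (A *m z) i 0 ^+ 2 <= gam * \sum_i p i 0 * z i 0 ^+ 2.
Proof.
have [K K1 KP] := dispersion_gap; have K0 : 0 < K by exact: lt_le_trans K1.
exists (1 - K^-1).
  by rewrite subr_ge0 invf_le1 // K1 /= ltrBlDr ltrDl invr_gt0.
move=> z /KP; rewrite -sqr_norm_mulmx; set D := dispersion z; set S := \sum_i _.
rewrite mulrBl mul1r => h.
by rewrite [K^-1 * _]mulrC lerBrDr lerD2l ler_pdivrMr // mulrC.
Qed.

(** The rank one matrix all of whose rows are [p^T]; [AinftyE] identifies it with the limit of the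
    powers of [A]. *)
Definition mean_mx : 'M[R]_N := \matrix_(i, j) p j 0.

Lemma mul_mean_mx (z : 'cV[R]_N) i : (mean_mx *m z) i 0 = \sum_j p j 0 * z j 0.
Proof. by rewrite mxE; apply: eq_bigr => j _; rewrite mxE. Qed.

Lemma mulmx_mean_mx : A *m mean_mx = mean_mx.
Proof.
apply/matrixP => i j; rewrite !mxE; under eq_bigr do rewrite mxE.
by rewrite -mulr_suml A_sum1 mul1r.
Qed.

Lemma mean_mulmx (z : 'cV[R]_N) :
  \sum_i p i 0 * (A *m z) i 0 = \sum_i p i 0 * z i 0.
Proof.
transitivity (((p^T *m A) *m z) 0 0); last first.
  by rewrite p_invariant mxE; apply: eq_bigr => i _; rewrite mxE.
by rewrite -mulmxA [RHS]mxE; apply: eq_bigr => i _; rewrite [in RHS]mxE.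
Qed.

Let sub_cVE z w i : (z - w) i 0 = z i 0 - w i 0.
Proof. by rewrite !mxE. Qed.

Lemma mean_sub_mean (z : 'cV[R]_N) :
  \sum_i p i 0 * (z - mean_mx *m z) i 0 = 0.
Proof.
under eq_bigr do rewrite sub_cVE mul_mean_mx mulrBr.
by rewrite sumrB -mulr_suml p_sum1 mul1r subrr.
Qed.

Lemma sub_mean_le (z : 'cV[R]_N) :
  \sum_i p i 0 * (z - mean_mx *m z) i 0 ^+ 2 <= \sum_i p i 0 * z i 0 ^+ 2.
Proof.
set m := \sum_j p j 0 * z j 0.
have -> : \sum_i p i 0 * (z - mean_mx *m z) i 0 ^+ 2
    = \sum_i p i 0 * z i 0 ^+ 2 - m ^+ 2; last by rewrite gerBl sqr_ge0.
under eq_bigr do rewrite sub_cVE mul_mean_mx -/m.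
transitivity (\sum_i p i 0 * z i 0 ^+ 2 - \sum_i 2 * m * (p i 0 * z i 0)
  + \sum_i m ^+ 2 * p i 0).
  by rewrite -sumrB -big_split /=; apply: eq_bigr => i _; ring.
by rewrite -!mulr_sumr p_sum1 -/m; ring.
Qed.

(** [A ^+ k - mean_mx] acts as [A ^+ k] on the centered part of [z], and [A] keeps vectors centered,
    so the one-step contraction iterates. *)
Lemma exp_contracting gam :
  (forall z, \sum_i p i 0 * z i 0 = 0 ->
    \sum_i p i 0 * (A *m z) i 0 ^+ 2 <= gam * \sum_i p i 0 * z i 0 ^+ 2) ->
  0 <= gam ->
  forall k (z : 'cV[R]_N),
    \sum_i p i 0 * ((A ^+ k - mean_mx) *m z) i 0 ^+ 2
      <= gam ^+ k * \sum_i p i 0 * z i 0 ^+ 2.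
Proof.
move=> gamP gam0 k z.
have mean_id : mean_mx *m mean_mx = mean_mx.
  apply/matrixP => i j; rewrite !mxE; under eq_bigr do rewrite !mxE.
  by rewrite -mulr_suml p_sum1 mul1r.
have exp_mean l : A ^+ l *m mean_mx = mean_mx.
  elim: l => [|l IHl]; first by rewrite expr0 mul1mx.
  by rewrite exprS -mulmxA IHl mulmx_mean_mx.
have -> : (A ^+ k - mean_mx) *m z = A ^+ k *m (z - mean_mx *m z).
  by rewrite mulmxBl mulmxBr mulmxA exp_mean.
apply: le_trans (ler_wpM2l (exprn_ge0 k gam0) (sub_mean_le z)).
set w := z - _; suff [] : \sum_i p i 0 * (A ^+ k *m w) i 0 = 0 /\
  \sum_i p i 0 * (A ^+ k *m w) i 0 ^+ 2 <= gam ^+ k * \sum_i p i 0 * w i 0 ^+ 2 by [].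
elim: k => [|k [IH0 IHk]].
  by rewrite expr0 mul1mx expr0 mul1r mean_sub_mean.
rewrite exprS -mulmxA mean_mulmx; split=> //.
by apply: le_trans (gamP _ IH0) _; rewrite [in leRHS]exprS -mulrA ler_wpM2l.
Qed.

Lemma cvg_exp_mean : (fun k => A ^+ k) @ \oo --> mean_mx.
Proof.
have [gam /andP[gam0 gam1] gamP] := mulmx_contracting.
pose c := 1 + \sum_i (p i 0)^-1.
have pV_ge0 i : 0 <= (p i 0)^-1 by rewrite invr_ge0.
have c0 : 0 < c by rewrite ltr_wpDr // sumr_ge0.
have entry k i j : (mean_mx i j - (A ^+ k) i j) ^+ 2 <= c * gam ^+ k.
  have pi0 := invariant_gt0 i.
  (* A basis vector has energy at most 1 and selects column [j] of the difference. *)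
  have := exp_contracting gamP gam0 k (delta_mx j 0); rewrite -colE => h.
  have {}h : p i 0 * (mean_mx i j - (A ^+ k) i j) ^+ 2 <= gam ^+ k.
    apply: le_trans (_ : gam ^+ k * 1 <= _); last by rewrite mulr1.
    apply: le_trans (le_trans h _).
      rewrite (bigD1 i) //= !mxE -sqrrN opprB lerDl sumr_ge0 // => l _.
      by rewrite mulr_ge0 ?sqr_ge0.
    rewrite ler_wpM2l ?exprn_ge0 // -p_sum1 ler_sum // => l _.
    by rewrite ler_piMr // !mxE; case: (_ && _); rewrite ?expr1n ?expr0n.
  apply: le_trans (_ : (p i 0)^-1 * gam ^+ k <= _).
    by rewrite mulrC ler_pdivlMr // mulrC.
  rewrite ler_wpM2r ?exprn_ge0 // /c (bigD1 i) //= addrCA lerDl addr_ge0 //.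
  by rewrite sumr_ge0.
apply/cvgrPdist_le => e e0.
have gam_cvg : (fun k => gam ^+ k) @ \oo --> (0 : R).
  by apply: cvg_expr; rewrite ger0_norm.
near=> k.
have gam_le : gam ^+ k <= e ^+ 2 / c.
  have := ler_norm (gam ^+ k); move/le_trans; apply.
  near: k; move/cvgr0Pnorm_le: gam_cvg; apply.
  by rewrite divr_gt0 ?exprn_gt0.
rewrite [leLHS]/Num.norm/= mx_normrE; apply/bigmax_leP; split=> [|[i j] _] /=.
  exact: ltW.
rewrite -(@ler_pXn2r _ 2) ?nnegrE ?(ltW e0) // real_normK ?num_real // !mxE.
have := entry k i j; rewrite mxE => /le_trans; apply.
by rewrite mulrC -ler_pdivlMr.
Unshelve. all: by end_near. Qed.

Lemma AinftyE : Ainfty A = mean_mx.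
Proof. by apply: cvg_lim; [exact: norm_hausdorff|exact: cvg_exp_mean]. Qed.

Lemma sub_Ainfty_le : exists2 gam : R, 0 <= gam < 1 & forall z,
  vnorm_w p ((A - Ainfty A) *m z) <= gam * vnorm_w p z.
Proof.
have [gam /andP[gam0 gam1] gamP] := mulmx_contracting.
exists (Num.sqrt gam) => [|z].
  by rewrite sqrtr_ge0 /= -sqrtr1 ltr_sqrt.
rewrite AinftyE -(@ler_pXn2r _ 2) ?nnegrE ?mulr_ge0 ?sqrtr_ge0 //.
rewrite exprMn !sqr_wl2 // sqr_sqrtr //.
under eq_bigr do rewrite real_normK ?num_real //.
under [X in _ <= _ * X]eq_bigr do rewrite real_normK ?num_real //.
by have := exp_contracting gamP gam0 1 z; rewrite !expr1.
Qed.

Lemma rho1_lt1 : rho1 A p < 1.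
Proof.
have [gam /andP[gam0 gam1] gamP] := sub_Ainfty_le.
apply: le_lt_trans gam1; apply: ge_sup.
  exists (vnorm_w p ((A - Ainfty A) *m 0)); exists 0 => //=.
  by rewrite /vnorm_w /wl2 big1 ?sqrtr0 // => i _; rewrite mxE normr0 expr0n mulr0.
move=> _ [z /= z1 <-]; apply: le_trans (gamP z) _.
by rewrite ler_piMr.
Qed.

(** Rescale [z] to norm 1 and use that [rho1] is a supremum of a set bounded by [gam]; for norm 0
    the bound by [gam] already forces 0 on the left. *)
Lemma le_rho1 z :
  vnorm_w p ((A - Ainfty A) *m z) <= rho1 A p * vnorm_w p z.
Proof.
have [gam /andP[gam0 gam1] gamP] := sub_Ainfty_le.
have sup_gam : has_ubound [set vnorm_w p ((A - Ainfty A) *m z) |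
    z in [set z | vnorm_w p z <= 1]].
  exists gam => _ [w /= w1 <-]; apply: le_trans (gamP w) _.
  by rewrite ler_piMr.
have vnormZ c w : 0 <= c -> vnorm_w p (c *: w) = c * vnorm_w p w.
  move=> c0; rewrite /vnorm_w -wl2Z //; congr Num.sqrt.
  by apply: eq_bigr => i _; rewrite mxE normrM (ger0_norm c0).
have [z_eq0|z_gt0] := leP (vnorm_w p z) 0.
  have /eqP z0 : vnorm_w p z == 0 by rewrite eq_le z_eq0 sqrtr_ge0.
  by apply: le_trans (gamP z) _; rewrite z0 !mulr0.
rewrite -ler_pdivrMr // mulrC -vnormZ ?invr_ge0 ?(ltW z_gt0) // scalemxAr.
rewrite /rho1 /mnorm_w /induced_norm; apply: (ub_le_sup sup_gam).
exists ((vnorm_w p z)^-1 *: z) => //=.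
by rewrite vnormZ ?invr_ge0 ?(ltW z_gt0) // mulVf ?gt_eqF.
Qed.

(** The constant vector 1 has weighted norm 1, so [rho1] bounds a norm. *)
Lemma rho1_ge0 : 0 <= rho1 A p.
Proof.
have := le_rho1 (const_mx 1); have : vnorm_w p (const_mx 1) = 1.
  rewrite /vnorm_w /wl2 -[RHS]sqrtr1; congr Num.sqrt; rewrite -[RHS]p_sum1.
  by apply: eq_bigr => i _; rewrite mxE normr1 expr1n mulr1.
by move=> ->; rewrite mulr1; apply: le_trans; rewrite sqrtr_ge0.
Qed.

End Consensus.

(** * Hilbert-space valued quadratic forms *)

Section QuadraticForms.
Context {R : realType} {V : lmodType R} (f : V -> V -> R).
Hypotheses (fC : forall x y, f x y = f y x)
  (fDr : forall x y z, f x (y + z) = f x y + f x z)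
  (fZr : forall a x y, f x (a *: y) = a * f x y).

Definition quad n (Q : 'I_n -> 'I_n -> R) (z : 'I_n -> V) : R :=
  \sum_i \sum_j Q i j * f (z i) (z j).

Lemma form_sumr (I : finType) x (F : I -> V) : f x (\sum_i F i) = \sum_i f x (F i).
Proof.
have f0 : f x 0 = 0 by rewrite -(scale0r 0) fZr mul0r.
by apply: (big_morph (f x) (fun y z => fDr x y z) f0).
Qed.

Lemma quad_rank1 n (b : 'I_n -> R) z :
  quad (fun i j => b i * b j) z = f (\sum_i b i *: z i) (\sum_i b i *: z i).
Proof.
rewrite form_sumr; apply: eq_bigr => i _; rewrite fZr fC form_sumr mulr_sumr.
by apply: eq_bigr => j _; rewrite fZr mulrA.
Qed.

Lemma quadB n (Q Q' : 'I_n -> 'I_n -> R) z :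
  quad (fun i j => Q i j - Q' i j) z = quad Q z - quad Q' z.
Proof.
rewrite -sumrB; apply: eq_bigr => i _; rewrite -sumrB.
by apply: eq_bigr => j _; rewrite mulrBl.
Qed.

Lemma quadZ n c (Q : 'I_n -> 'I_n -> R) z :
  quad (fun i j => c * Q i j) z = c * quad Q z.
Proof.
rewrite mulr_sumr; apply: eq_bigr => i _; rewrite mulr_sumr.
by apply: eq_bigr => j _; rewrite mulrA.
Qed.

Lemma quad_recl n (Q : 'I_n.+1 -> 'I_n.+1 -> R) z :
    (forall i j, Q i j = Q j i) ->
  quad Q z = Q ord0 ord0 * f (z ord0) (z ord0)
    + 2 * f (z ord0) (\sum_j Q ord0 (lift ord0 j) *: z (lift ord0 j))
    + quad (fun i j => Q (lift ord0 i) (lift ord0 j)) (z \o lift ord0).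
Proof.
move=> Qsym; rewrite /quad big_ord_recl /= big_ord_recl /=.
under [X in _ + X = _]eq_bigr do rewrite big_ord_recl /=.
rewrite big_split /= form_sumr.
set S := \sum_(i < n) _.
have -> : \sum_(i < n) Q (lift ord0 i) ord0 * f (z (lift ord0 i)) (z ord0) = S.
  by apply: eq_bigr => j _; rewrite Qsym fC.
have -> : \sum_i f (z ord0) (Q ord0 (lift ord0 i) *: z (lift ord0 i)) = S.
  by apply: eq_bigr => j _; rewrite fZr.
ring.
Qed.

(** The defect in a weighted operator bound is a quadratic form with real coefficients that do not
    depend on [f]; this lets the bound pass from scalars to vectors. *)
Lemma quad_weighted_mul n (p : 'I_n -> R) (M : 'M[R]_n) c z :
  quad (fun j k => c * ((j == k)%:R * p j) - \sum_i p i * (M i j * M i k)) z =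
  c * (\sum_i p i * f (z i) (z i)) -
    \sum_i p i * f (\sum_j M i j *: z j) (\sum_j M i j *: z j).
Proof.
rewrite quadB quadZ; congr (_ * _ - _).
  apply: eq_bigr => i _; rewrite (bigD1 i) //= eqxx mul1r big1 ?addr0 // => j ji.
  by rewrite eq_sym (negPf ji) !mul0r.
under [RHS]eq_bigr do rewrite -quad_rank1 -quadZ.
rewrite /quad [RHS]exchange_big; apply: eq_bigr => j _ /=.
by rewrite [RHS]exchange_big; apply: eq_bigr => k _ /=; rewrite mulr_suml.
Qed.

End QuadraticForms.

(** * Transfer of positivity from scalar to vector variables *)

Section PositiveForms.
Context {R : realType}.

(** Multiplication viewed as a bilinear form on the reals, so that the lemmas on [quad] also cover
    scalar variables. *)
Let mulf (x y : R^o) : R := x * y.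

Let mulfC x y : mulf x y = mulf y x. Proof. exact: mulrC. Qed.
Let mulfDr x y z : mulf x (y + z) = mulf x y + mulf x z.
Proof. exact: mulrDr. Qed.
Let mulfZr a x y : mulf x (a *: y) = a * mulf x y.
Proof. by rewrite /mulf mulrCA. Qed.

(* By induction on the size, completing the square in the first variable. *)
Lemma quad_ge0 (V : lmodType R) (f : V -> V -> R)
    (fC : forall x y, f x y = f y x)
    (fDr : forall x y z, f x (y + z) = f x y + f x z)
    (fZr : forall a x y, f x (a *: y) = a * f x y)
    (f_ge0 : forall x, 0 <= f x x)
    n (Q : 'I_n -> 'I_n -> R) (Qsym : forall i j, Q i j = Q j i) :
  (forall t : 'I_n -> R, 0 <= \sum_i \sum_j Q i j * (t i * t j)) ->
  forall z, 0 <= quad f Q z.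
Proof.
elim: n Q Qsym => [|n IHn] Q Qsym Qpos z; first by rewrite /quad big_ord0.
pose q := Q ord0 ord0; pose b j := Q ord0 (lift ord0 j).
pose Q' i j := Q (lift ord0 i) (lift ord0 j).
have expand (t0 : R) (t : 'I_n -> R) :
    0 <= q * t0 ^+ 2 + 2 * (t0 * \sum_j b j * t j) + quad mulf Q' t.
  have := Qpos (fun i => oapp t t0 (unlift ord0 i)).
  rewrite -[X in 0 <= X -> _]/(quad mulf Q (fun i => oapp t t0 (unlift ord0 i))).
  rewrite quad_recl // unlift_none /= -/q expr2.
  under [\sum_j _ *: _]eq_bigr do rewrite liftK /=.
  suff -> : quad mulf (fun i j => Q (lift ord0 i) (lift ord0 j))
    ((fun i => oapp t t0 (unlift ord0 i)) \o lift ord0) = quad mulf Q' t by [].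
  by apply: eq_bigr => i _; apply: eq_bigr => j _; rewrite /= !liftK.
have q_ge0 : 0 <= q.
  have := expand 1 (fun=> 0); rewrite expr1n mulr1 big1 => [|j _]; last by rewrite mulr0.
  rewrite !mulr0 addr0 /quad big1 ?addr0 // => i _.
  by rewrite big1 // => j _; rewrite /mulf mulr0 mulr0.
have Q'sym i j : Q' i j = Q' j i by exact: Qsym.
rewrite quad_recl //.
have [q0|qn0] := eqVneq q 0.
  have Q'pos (t : 'I_n -> R) : 0 <= \sum_i \sum_j Q' i j * (t i * t j).
    by have := expand 0 t; rewrite q0 !(mul0r, mulr0) !add0r.
  (* Without a square term in [t0], a nonzero cross coefficient would make the form unbounded
     below. *)
  have b0 j : b j = 0.
    pose c := Q' j j.
    have qc : quad mulf Q' (fun i => (i == j)%:R) = c.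
      rewrite /quad (bigD1 j) //= (bigD1 j) //= eqxx /mulf mulr1 mulr1.
      rewrite !big1 ?addr0 // => [i ij|i ij]; last by rewrite (negPf ij) mulr0 mulr0.
      by rewrite big1 // => k _; rewrite (negPf ij) mul0r mulr0.
    have bj : \sum_i b i * (i == j)%:R = b j.
      rewrite (bigD1 j) //= eqxx mulr1 big1 ?addr0 // => i ij.
      by rewrite (negPf ij) mulr0.
    have h t0 : 0 <= 2 * (t0 * b j) + c.
      by have := expand t0 (fun i => (i == j)%:R); rewrite q0 mul0r add0r bj qc.
    apply/eqP; apply/negPn/negP => bn0.
    (* This value of [t0] makes the affine expression equal to -1. *)
    have := h (- (c + 1) / (2 * b j)).
    rewrite (_ : 2 * _ = - (c + 1)); last by field.
    by rewrite opprD addrAC addNr add0r oppr_ge0 ler10.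
  rewrite -/q q0 mul0r add0r big1 => [|j _]; last by rewrite -/(b j) b0 scale0r.
  have -> : f (z ord0) 0 = 0 by have := fZr 0 (z ord0) 0; rewrite scale0r mul0r.
  by rewrite mulr0 add0r IHn.
have q_gt0 : 0 < q by rewrite lt0r qn0.
(* The Schur complement of the pivot [q]. *)
pose Q'' i j := Q' i j - q^-1 * (b i * b j).
set S := \sum_j _; rewrite (_ : _ + _ + _ =
    q * f (z ord0 + q^-1 *: S) (z ord0 + q^-1 *: S) + quad f Q'' (z \o lift ord0)).
  rewrite addr_ge0 ?mulr_ge0 //; apply: IHn => [i j|t].
    by rewrite /Q'' Q'sym [b i * _]mulrC.
  (* The minimizer in [t0], at which the completed square vanishes. *)
  have := expand (- (q^-1 * \sum_j b j * t j)) t.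
  rewrite -[X in _ -> 0 <= X]/(quad mulf Q'' t) quadB quadZ quad_rank1 //.
  have -> : \sum_i b i *: (t i : R^o) = \sum_j b j * t j by [].
  set s := \sum_j _; rewrite /mulf => h; apply: le_trans h _.
  by rewrite le_eqVlt; apply/orP; left; apply/eqP; field.
rewrite quadB quadZ quad_rank1 // -/S fDr fZr ![f (_ + _) _]fC !fDr !fZr.
rewrite [f S (z _)]fC -/q -/Q'.
by field.
Qed.

Lemma weighted_mulmx_le (V : lmodType R) (f : V -> V -> R)
    (fC : forall x y, f x y = f y x)
    (fDr : forall x y z, f x (y + z) = f x y + f x z)
    (fZr : forall a x y, f x (a *: y) = a * f x y)
    (f_ge0 : forall x, 0 <= f x x)
    n (p : 'I_n -> R) (M : 'M[R]_n) c :
    (forall z : 'cV[R]_n,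
      \sum_i p i * (M *m z) i 0 ^+ 2 <= c * \sum_i p i * z i 0 ^+ 2) ->
  forall z : 'I_n -> V,
    \sum_i p i * f (\sum_j M i j *: z j) (\sum_j M i j *: z j)
      <= c * \sum_i p i * f (z i) (z i).
Proof.
move=> Mc z; rewrite -subr_ge0 -quad_weighted_mul //; apply: quad_ge0 => // [i j|t].
  congr (_ * _ - _).
    by have [->|_] := eqVneq i j; rewrite ?mul0r.
  by apply: eq_bigr => k _; rewrite [M k i * _]mulrC.
rewrite -[leRHS]/(quad mulf _ t) quad_weighted_mul // subr_ge0.
have := Mc (\col_i t i); rewrite /mulf.
under eq_bigr do rewrite mxE; under [X in _ <= _ * X]eq_bigr do rewrite mxE expr2.
under eq_bigr do under eq_bigr do rewrite mxE.
by under eq_bigr do rewrite expr2.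
Qed.

End PositiveForms.

Section HilbertSpace.
Context {R : realType} {H : hilbertType R}.
Implicit Types x y : H.

Lemma innerC x y : inner x y = inner y x.
Proof. by rewrite hermC expr0 mul1r. Qed.

Lemma innerDl x y z : inner (x + y) z = inner x z + inner y z.
Proof. by rewrite linearDl. Qed.

Lemma innerZl a x y : inner (a *: x) y = a * inner x y.
Proof. by rewrite linearZl_LR. Qed.

Lemma innerDr x y z : inner x (y + z) = inner x y + inner x z.
Proof. by rewrite linearDr. Qed.

Lemma innerZr a x y : inner x (a *: y) = a * inner x y.
Proof. by rewrite innerC innerZl innerC. Qed.

Lemma inner_ge0 x : 0 <= inner x x.
Proof. by rewrite -sqr_norm_inner sqr_ge0. Qed.

Lemma weighted_mulmx_norm_le n (p : 'cV[R]_n) (M : 'M[R]_n) c :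
    (forall z : 'cV[R]_n,
      \sum_i p i 0 * (M *m z) i 0 ^+ 2 <= c * \sum_i p i 0 * z i 0 ^+ 2) ->
  forall z : 'I_n -> H,
    \sum_i p i 0 * `|\sum_j M i j *: z j| ^+ 2 <= c * \sum_i p i 0 * `|z i| ^+ 2.
Proof.
move=> Mc z; have := weighted_mulmx_le innerC innerDr innerZr inner_ge0 Mc z.
under eq_bigr do rewrite -sqr_norm_inner.
by under [X in _ <= _ * X]eq_bigr do rewrite -sqr_norm_inner.
Qed.

(** The last term is the gain that makes relaxed steps approach the fixed points strictly. *)
Lemma sqr_norm_convex a x y :
  `|x + a *: (y - x)| ^+ 2 =
  (1 - a) * `|x| ^+ 2 + a * `|y| ^+ 2 - a * (1 - a) * `|y - x| ^+ 2.
Proof.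
rewrite !sqr_norm_inner -(scaleN1r x).
rewrite !(innerDr, innerZr, innerDl, innerZl) [inner y x]innerC.
ring.
Qed.

End HilbertSpace.

(** * The direct sum and the relaxed operator *)

Section GeometricSequence.
Context {R : realType}.

Lemma geometric_limit (V : completeNormedModType R) (u : nat -> V) (C r : R) :
    0 <= C -> 0 < r < 1 -> (forall k, `|u k.+1 - u k| <= C * r ^+ k) ->
  exists l : V, forall k, `|u k - l| <= C / (1 - r) * r ^+ k.
Proof.
move=> C0 /andP[r0 r1] uC; have r1' : 0 < 1 - r by rewrite subr_gt0.
(* The difference of powers is the exact partial geometric sum, which lets the induction close. *)
have dist_le k m : `|u k - u (k + m)%N| <= C / (1 - r) * (r ^+ k - r ^+ (k + m)).
  elim: m => [|m IHm]; first by rewrite addn0 !subrr normr0 mulr0.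
  apply: le_trans (ler_distD (u (k + m)%N) _ _) _.
  rewrite [leRHS](_ : _ = C / (1 - r) * (r ^+ k - r ^+ (k + m)) + C * r ^+ (k + m)).
    by rewrite lerD // addnS distrC.
  by rewrite addnS exprS; field; rewrite gt_eqF.
have /cvg_ex[l u_l] : cvgn u.
  pose v := telescope u.
  have vE : series v = (fun n => u n - u 0%N).
    by rewrite funeqE => n; rewrite /series /= telescope_sumr.
  have : cvgn (series v).
    apply: normed_cvg; apply: (@series_le_cvg _ _ (geometric C r)).
    - by move=> n /=; rewrite normr_ge0.
    - by move=> n; rewrite geometric_ge0 // ltW.
    - by move=> n /=; exact: uC.
    - by apply: is_cvg_geometric_series; rewrite ger0_norm // ltW.
  rewrite vE => v_cvg.
  have -> : u = (fun n => (u n - u 0%N) + u 0%N) by rewrite funeqE => n; rewrite subrK.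
  by apply: is_cvgD => //; exact: is_cvg_cst.
exists l => k; apply/ler_addgt0Pr => e e0.
have /cvgrPdist_le/(_ e e0)[m _ u_m] := u_l.
apply: le_trans (ler_distD (u (k + m)%N) _ _) _; apply: lerD.
  apply: le_trans (dist_le k m) _; rewrite ler_wpM2l ?divr_ge0 ?(ltW r1') //.
  by rewrite gerBl exprn_ge0 // ltW.
by rewrite distrC; apply: u_m; rewrite /= leq_addl.
Qed.

End GeometricSequence.

Section DirectSumNorm.
Context {R : realType} {N : nat} {H : 'I_N -> hilbertType R}.
Implicit Types (x y z : dsum H).

(** [dsum H] is only given a group structure, so scaling is a separate operation. *)
Definition dscale (a : R) x : dsum H := fun i => a *: x i.

Lemma sqr_dnorm x : dnorm x ^+ 2 = \sum_i `|x i| ^+ 2.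
Proof. exact: sqr_l2. Qed.

Lemma dnorm_ge0 x : 0 <= dnorm x.
Proof. exact: sqrtr_ge0. Qed.

Lemma ler_dnorm x i : `|x i| <= dnorm x.
Proof. exact: (@ler_l2 _ _ (fun i => `|x i|)). Qed.

Lemma dnormD x y : dnorm (x + y) <= dnorm x + dnorm y.
Proof.
apply: le_trans _ (l2D _ _); apply: l2_le => i.
by rewrite normr_ge0 ler_normD.
Qed.

Lemma dnormN x : dnorm (- x) = dnorm x.
Proof. by congr Num.sqrt; apply: eq_bigr => i _; rewrite normrN. Qed.

Lemma dnormBC x y : dnorm (x - y) = dnorm (y - x).
Proof. by rewrite -dnormN opprB. Qed.

Lemma dnorm_triangle y x z : dnorm (x - z) <= dnorm (x - y) + dnorm (y - z).
Proof. by rewrite -[x - z](subrKA y); exact: dnormD. Qed.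

Lemma dnormZ a x : 0 <= a -> dnorm (dscale a x) = a * dnorm x.
Proof.
move=> a0; rewrite -l2Z //; congr Num.sqrt; apply: eq_bigr => i _.
by rewrite normrZ ger0_norm.
Qed.

(** Limits are taken block by block, in the complete spaces [H i]; the constant gains the [l2] norm
    of the all-one family. *)
Lemma dnorm_geometric_limit (u : nat -> dsum H) (C r : R) :
    0 <= C -> 0 < r < 1 -> (forall k, dnorm (u k.+1 - u k) <= C * r ^+ k) ->
  exists l : dsum H, exists2 K : R, 0 <= K &
    forall k, dnorm (u k - l) <= K * r ^+ k.
Proof.
move=> C0 r01 uC; have /andP[r0 r1] := r01.
have ex i : exists l : H i, forall k, `|u k i - l| <= C / (1 - r) * r ^+ k.
  apply: geometric_limit => // k; apply: le_trans (uC k).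
  exact: (ler_dnorm (u k.+1 - u k)).
pose l : dsum H := fun i => sval (cid (ex i)).
have K0 : 0 <= C / (1 - r) by rewrite divr_ge0 // subr_ge0 ltW.
exists l, (C / (1 - r) * l2 (fun _ : 'I_N => 1)) => [|k].
  by rewrite mulr_ge0 ?l2_ge0.
have c0 : 0 <= C / (1 - r) * r ^+ k by rewrite mulr_ge0 ?exprn_ge0 ?(ltW r0).
rewrite mulrAC -l2Z //.
apply: (@l2_le _ _ (fun i => `|(u k - l) i|)) => i.
by rewrite normr_ge0 mulr1 /=; exact: (svalP (cid (ex i)) k).
Qed.

Lemma distance_le (X : set (dsum H)) z x : X x -> distance X z <= dnorm (z - x).
Proof.
move=> Xx; apply: ge_inf; last by exists x.
by exists 0 => _ [y _ <-]; exact: dnorm_ge0.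
Qed.

Lemma le_distance (X : set (dsum H)) z c : X !=set0 ->
  (forall x, X x -> c <= dnorm (z - x)) -> c <= distance X z.
Proof.
move=> [x Xx] cX; apply: lb_le_inf; first by exists (dnorm (z - x)), x.
by move=> _ [y Xy <-]; exact: cX.
Qed.

Lemma distance_ge0 (X : set (dsum H)) z : X !=set0 -> 0 <= distance X z.
Proof. by move=> X0; apply: le_distance => // x _; exact: dnorm_ge0. Qed.

Lemma distanceD (X : set (dsum H)) z y : X !=set0 ->
  distance X (z + y) <= distance X z + dnorm y.
Proof.
move=> X0; rewrite -lerBlDr; apply: le_distance => // x Xx.
rewrite lerBlDr; apply: le_trans (distance_le _ Xx) _.
by rewrite addrAC; exact: dnormD.
Qed.

End DirectSumNorm.

(** * Distance to the fixed points under a relaxed step *)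

Section Relaxation.
Context {R : realType} {N : nat} {H : 'I_N -> hilbertType R}
  (F : dsum H -> dsum H) (kappa delta alpha : R).
Hypotheses (F_quasi_nonexpansive : quasi_nonexpansive F) (F_fix : Fix F !=set0).

(** Through a fixed point [y], both [F x] and [x] are within [dnorm (x - y)] of [y]; then take the
    infimum over [y]. *)
Lemma residual_le_distance x : dnorm (F x - x) <= 2 * distance (Fix F) x.
Proof.
rewrite -ler_pdivrMl //; apply: le_distance => // y Fy.
rewrite ler_pdivrMl //; apply: le_trans (dnorm_triangle y _ _) _.
by rewrite [dnorm (y - x)]dnormBC mulr_natl mulr2n lerD2r F_quasi_nonexpansive.
Qed.

Hypotheses (kappa_gt0 : 0 < kappa)
  (F_regular : forall x, distance (Fix F) x <= kappa * dnorm (F x - x))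
  (delta_gt0 : 0 < delta) (alpha_gt0 : 0 < alpha) (alpha_lt : alpha < 1 - delta).

(** For each fixed point [y], the convexity identity and quasi-nonexpansiveness bound
    [dnorm (x' - y) ^+ 2] by [dnorm (x - y) ^+ 2 - alpha * (1 - alpha) * r ^+ 2]. After the infimum
    over [y], regularity gives [r >= D / kappa], and [1 - alpha > delta]. *)
Lemma sqr_distance_relaxed x :
  distance (Fix F) (x + dscale alpha (F x - x)) ^+ 2
    <= (1 - delta * alpha / kappa ^+ 2) * distance (Fix F) x ^+ 2.
Proof.
have [d0 a0 a_lt] := And3 delta_gt0 alpha_gt0 alpha_lt.
have a1 : 0 <= 1 - alpha by lra.
set x' := x + _; set D := distance _ x; set D' := distance _ x'.
have D0 : 0 <= D by exact: distance_ge0.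
have D'0 : 0 <= D' by exact: distance_ge0.
set r := dnorm (F x - x).
have step y : Fix F y ->
    D' ^+ 2 + alpha * (1 - alpha) * r ^+ 2 <= dnorm (x - y) ^+ 2.
  move=> Fy.
  have Fxy : dnorm (F x - y) ^+ 2 <= dnorm (x - y) ^+ 2.
    by rewrite lerXn2r ?nnegrE ?dnorm_ge0 // F_quasi_nonexpansive.
  have D'y : D' ^+ 2 <= dnorm (x' - y) ^+ 2.
    by rewrite lerXn2r ?nnegrE ?dnorm_ge0 // distance_le.
  have : dnorm (x' - y) ^+ 2 = (1 - alpha) * dnorm (x - y) ^+ 2
      + alpha * dnorm (F x - y) ^+ 2 - alpha * (1 - alpha) * r ^+ 2.
    rewrite !sqr_dnorm !mulr_sumr -big_split -sumrB; apply: eq_bigr => i _ /=.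
    have := sqr_norm_convex alpha (x i - y i) (F x i - y i).
    rewrite opprB addrA subrK => <-; congr (`|_| ^+ 2).
    by rewrite addrAC.
  move: D'y Fxy; set A := dnorm (x' - y) ^+ 2; set B := dnorm (x - y) ^+ 2.
  set E := dnorm (F x - y) ^+ 2; set G := r ^+ 2; nra.
have {step} : D' ^+ 2 + alpha * (1 - alpha) * r ^+ 2 <= D ^+ 2.
  have S0 : 0 <= D' ^+ 2 + alpha * (1 - alpha) * r ^+ 2.
    by rewrite addr_ge0 ?mulr_ge0 ?sqr_ge0 ?dnorm_ge0 ?(ltW a0).
  (* The distance is an infimum of norms, not of squares, hence the passage through the square
     root. *)
  rewrite -[leLHS](sqr_sqrtr S0) lerXn2r ?nnegrE ?sqrtr_ge0 //.
  apply: le_distance => // y Fy.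
  by rewrite -[leRHS](ger0_norm (dnorm_ge0 _)) -sqrtr_sqr ler_wsqrtr // step.
have : D ^+ 2 / kappa ^+ 2 <= r ^+ 2.
  rewrite -expr_div_n lerXn2r ?nnegrE ?dnorm_ge0 ?divr_ge0 ?(ltW kappa_gt0) //.
  by rewrite ler_pdivrMr // mulrC F_regular.
have -> : (1 - delta * alpha / kappa ^+ 2) * D ^+ 2
  = D ^+ 2 - delta * alpha * (D ^+ 2 / kappa ^+ 2) by ring.
have Q0 : 0 <= D ^+ 2 / kappa ^+ 2 by rewrite divr_ge0 ?sqr_ge0.
set Q := D ^+ 2 / _ in Q0 *; set G := r ^+ 2 => QG hD.
have : delta * alpha * Q <= alpha * (1 - alpha) * G.
  rewrite [delta * _]mulrC -!mulrA ler_pM2l // ler_pM ?(ltW delta_gt0) //; lra.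
lra.
Qed.

Lemma distance_relaxed x :
  distance (Fix F) (x + dscale alpha (F x - x))
    <= (1 - delta * alpha / (4 * kappa ^+ 2)) * distance (Fix F) x.
Proof.
have := sqr_distance_relaxed x.
set D' := distance _ (_ + _); set D := distance _ x.
have D0 : 0 <= D by exact: distance_ge0.
have D'0 : 0 <= D' by exact: distance_ge0.
have k0 : kappa != 0 by rewrite gt_eqF.
set q := delta * alpha / (4 * kappa ^+ 2).
have q0 : 0 < q by rewrite divr_gt0 ?mulr_gt0 ?exprn_gt0.
have ->: delta * alpha / kappa ^+ 2 = 4 * q by rewrite /q; field.
(* For [q <= 1], [1 - 4 * q <= (1 - q) ^+ 2] and roots can be taken. For [q > 1] the factor
   [1 - 4 * q] is negative, which forces both distances to be 0. *)
have [q1|q1] := leP q 1 => h.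
  rewrite -(@ler_pXn2r _ 2) ?nnegrE ?mulr_ge0 ?subr_ge0 //.
  apply: le_trans h _; rewrite exprMn ler_wpM2r ?sqr_ge0 //; nra.
have D20 : D ^+ 2 = 0.
  apply/eqP; rewrite eq_le sqr_ge0 andbT.
  move: h (sqr_ge0 D') (sqr_ge0 D); set X := D ^+ 2; set Y := _ ^+ 2 => h Y0 X0.
  have : 0 <= (q - 1) * X by rewrite mulr_ge0 // subr_ge0 ltW.
  by nra.
have /eqP := D20; rewrite expf_eq0 /= => /eqP D_eq0.
move: h; rewrite D20 !mulr0 D_eq0 mulr0 => h.
have : D' ^+ 2 == 0 by rewrite eq_le h sqr_ge0.
by rewrite expf_eq0 /= => /eqP ->.
Qed.

End Relaxation.

(** * Linear rates and the root condition *)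

Section LinearRate.
Context {R : realType}.

(* [e + lam * d] contracts as soon as [b / (1 - t) < lam < (1 - s) / c]. *)
Lemma coupled_linear_rate (e d : nat -> R) (s b c t : R) :
    (forall k, 0 <= e k) -> (forall k, 0 <= d k) ->
    s < 1 -> t < 1 -> 0 <= b -> 0 < c -> b * c < (1 - s) * (1 - t) ->
    (forall k, e k.+1 <= s * e k + b * d k) ->
    (forall k, d k.+1 <= c * e k + t * d k) ->
  exists C r : R, [/\ 0 <= C, 0 < r < 1 &
    forall k, e k <= C * r ^+ k /\ d k <= C * r ^+ k].
Proof.
move=> e0 d0 s1 t1 b0 c0 bc eS dS.
have s1' : 0 < 1 - s by rewrite subr_gt0.
have t1' : 0 < 1 - t by rewrite subr_gt0.
(* The midpoint of the admissible interval, nonempty because [b * c < (1 - s) * (1 - t)]. *)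
pose lam := (b / (1 - t) + (1 - s) / c) / 2.
have lo_hi : b / (1 - t) < (1 - s) / c.
  by rewrite ltr_pdivrMr // mulrAC ltr_pdivlMr.
have lo0 : 0 <= b / (1 - t) by rewrite divr_ge0 // ltW.
have lo_lam : b / (1 - t) < lam by rewrite /lam; lra.
have lam_hi : lam < (1 - s) / c by rewrite /lam; lra.
have lam0 : 0 < lam by exact: le_lt_trans lo_lam.
(* The contraction factors of the two weighted components; [2^-1] only keeps [r] positive. *)
pose r := Num.max (Num.max (s + lam * c) (t + b / lam)) 2^-1.
have r_gt0 : 0 < r by rewrite /r lt_max invr_gt0 ltr0n orbT.
have r_lt1 : r < 1.
  rewrite /r !gt_max; apply/andP; split; last by lra.
  move: lam_hi lo_lam; rewrite ltr_pdivlMr // ltr_pdivrMr // => h1 h2.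
  rewrite -ltrBrDl h1 /= -ltrBrDl ltr_pdivrMr //.
  by rewrite mulrC.
have V_le k : e k + lam * d k <= (e 0%N + lam * d 0%N) * r ^+ k.
  elim: k => [|k IHk]; first by rewrite mulr1.
  rewrite exprSr mulrA; apply: le_trans (ler_wpM2r (ltW r_gt0) IHk).
  have h1 : (s + lam * c) * e k <= r * e k by rewrite ler_wpM2r // /r !le_max lexx.
  have h2 : (lam * t + b) * d k <= r * lam * d k.
    rewrite ler_wpM2r // -ler_pdivrMr //.
    rewrite [leLHS](_ : _ = t + b / lam); last by field; rewrite gt_eqF.
    by rewrite /r !le_max lexx orbT.
  have h3 := eS k; have h4 := ler_wpM2l (ltW lam0) (dS k).
  have -> : (e k + lam * d k) * r = r * e k + r * lam * d k by ring.
  apply: le_trans (lerD h3 h4) _; apply: le_trans (lerD h1 h2).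
  by rewrite le_eqVlt; apply/orP; left; apply/eqP; ring.
have V0 : 0 <= e 0%N + lam * d 0%N.
  by apply: addr_ge0 => //; apply: mulr_ge0 => //; exact: ltW.
set V := e 0%N + _ in V0 V_le.
have VC : 0 <= V / lam by rewrite divr_ge0 // ltW.
exists (V + V / lam), r; split=> [||k]; [exact: addr_ge0|by rewrite r_gt0|].
have rk : 0 <= r ^+ k by rewrite exprn_ge0 // ltW.
have := V_le k; have := mulr_ge0 (ltW lam0) (d0 k) => ld0 Vk.
split; rewrite mulrDl.
  apply: le_trans (_ : V * r ^+ k <= _); last by rewrite lerDl mulr_ge0.
  by apply: le_trans Vk; rewrite lerDl.
apply: le_trans (_ : V / lam * r ^+ k <= _); last by rewrite lerDr mulr_ge0.
rewrite mulrAC ler_pdivlMr // mulrC; apply: le_trans Vk.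
by rewrite lerDr.
Qed.

Lemma le0_of_le_geometric (a C r : R) : 0 < r < 1 ->
  (forall k, a <= C * r ^+ k) -> a <= 0.
Proof.
move=> /andP[r0 r1] aC.
have cvg0 : geometric C r @ \oo --> (0 : R).
  by apply: cvg_geometric; rewrite ger0_norm // ltW.
have <- : limn (geometric C r) = 0 by apply: cvg_lim cvg0; exact: norm_hausdorff.
apply: limr_ge; first by apply/cvg_ex; exists 0.
by apply: nearW => k; exact: aC.
Qed.

(** For [Q > 0] the point [P / Q] is a positive root, so [alpha] lies below it and [aL] is finite;
    for [Q = 0] the claim is [0 < P]. *)
Lemma smallest_positive_root_gt0 (f : R -> R) (P Q alpha : R) (aL : \bar R) :
    (forall a, f a = a * (P - a * Q)) -> 0 < P -> 0 <= Q ->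
    smallest_positive_root f aL -> 0 < alpha -> (alpha%:E < aL)%E ->
  0 < P - alpha * Q.
Proof.
move=> fE P0; rewrite le_eqVlt => /predU1P[<-|Q0]; first by rewrite mulr0 subr0.
have root : f (P / Q) = 0 by rewrite fE divfK ?gt_eqF // subrr mulr0.
have PQ0 : 0 < P / Q by rewrite divr_gt0.
case: aL => [r| |] //= => [[r0 _ r_min]|no_root] a0; last by case: (no_root _ PQ0).
by rewrite lte_fin subr_gt0 -ltr_pdivlMr // => /lt_le_trans; apply; exact: r_min.
Qed.

(** The second row of [1 - Theta] is a multiple of [a] and the first is affine in [a]. *)
Lemma det_sub_Theta N (A : 'M[R]_N) p L c1 c2 kappa delta a :
  \det (1%:M - Theta A p L c1 c2 kappa delta a) =
  a * ((1 - rho1 A p) * (delta / (4 * kappa ^+ 2))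
    - a * (theta5 p L c1 c2 * (delta / (4 * kappa ^+ 2))
      + 2 * c2 * Num.sqrt (2 * varpi p) * ((Lbar L + 1) / c1))).
Proof.
rewrite (expand_det_row _ ord0) !big_ord_recl big_ord0 /cofactor !det_mx11 !mxE /=.
rewrite /bump /=.
ring.
Qed.

End LinearRate.

(** * Norms of network states *)

Section NetworkNorms.
Context {R : realType} {N : nat} {H : 'I_N -> hilbertType R}.
Implicit Types (z u v : 'I_N -> dsum H) (p : 'cV[R]_N) (M A : 'M[R]_N).

Definition average p z : dsum H := fun l => \sum_j p j 0 *: z j l.

(** The Kronecker product of [M] with the identity, acting on network states. *)
Definition mix M z : 'I_N -> dsum H := fun i l => \sum_j M i j *: z j l.

Lemma sqr_nnorm z : nnorm z ^+ 2 = \sum_i \sum_l `|z i l| ^+ 2.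
Proof. by rewrite /nnorm sqr_l2; apply: eq_bigr => i _; rewrite sqr_dnorm. Qed.

Lemma sqr_nnorm_w p z : (forall i, 0 <= p i 0) ->
  nnorm_w p z ^+ 2 = \sum_i p i 0 * \sum_l `|z i l| ^+ 2.
Proof.
by move=> p0; rewrite /nnorm_w sqr_wl2 //; apply: eq_bigr => i _; rewrite sqr_dnorm.
Qed.

Lemma nnorm_wD p u v : (forall i, 0 <= p i 0) ->
  nnorm_w p (fun i => u i + v i) <= nnorm_w p u + nnorm_w p v.
Proof.
move=> p0; apply: le_trans _ (wl2D _ _ p0); apply: wl2_le => // i.
by rewrite dnorm_ge0 dnormD.
Qed.

(** For fixed [l] the vectors [z i l] share the space [H l], where the scalar bound transfers; the
    squares are then summed over [l]. *)
Lemma nnorm_w_mix_le p M rho : (forall i, 0 <= p i 0) -> 0 <= rho ->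
    (forall z : 'cV[R]_N, vnorm_w p (M *m z) <= rho * vnorm_w p z) ->
  forall z, nnorm_w p (mix M z) <= rho * nnorm_w p z.
Proof.
move=> p0 rho0 Mrho z.
have Mrho2 (w : 'cV[R]_N) :
    \sum_i p i 0 * (M *m w) i 0 ^+ 2 <= rho ^+ 2 * \sum_i p i 0 * w i 0 ^+ 2.
  have vE (y : 'cV[R]_N) : \sum_i p i 0 * y i 0 ^+ 2 = vnorm_w p y ^+ 2.
    by rewrite sqr_wl2 //; apply: eq_bigr => i _; rewrite real_normK ?num_real.
  by rewrite !vE -exprMn lerXn2r ?nnegrE ?mulr_ge0 ?wl2_ge0.
rewrite -(@ler_pXn2r _ 2) ?nnegrE ?mulr_ge0 ?wl2_ge0 //.
rewrite exprMn !sqr_nnorm_w //.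
under eq_bigr do rewrite mulr_sumr; under [X in _ * X]eq_bigr do rewrite mulr_sumr.
rewrite exchange_big [X in _ * X]exchange_big mulr_sumr ler_sum // => l _ /=.
exact: (weighted_mulmx_norm_le Mrho2 (fun i => z i l)).
Qed.

(** Jensen's inequality in row [l] bounds the squared block by an [A l j]-weighted sum, and the
    weights are at most 1. *)
Lemma mix_diag_le A z : row_stochastic A ->
  dnorm (fun l => mix A z l l : H l) <= nnorm z.
Proof.
move=> [A0 A1]; rewrite -(@ler_pXn2r _ 2) ?nnegrE ?dnorm_ge0 ?l2_ge0 //.
rewrite sqr_dnorm sqr_nnorm exchange_big ler_sum // => l _ /=.
apply: le_trans (_ : (\sum_j A l j * `|z j l|) ^+ 2 <= _).
  rewrite lerXn2r ?nnegrE ?sumr_ge0 // => [j _|]; first by rewrite mulr_ge0.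
  apply: le_trans (ler_norm_sum _ _ _) _; rewrite ler_sum // => j _.
  by rewrite normrZ ger0_norm.
apply: le_trans (sqr_mean_le _ (A0 l) (A1 l)) _; rewrite ler_sum // => j _.
rewrite ler_piMl ?sqr_ge0 // -(A1 l) (bigD1 j) //= lerDl sumr_ge0 //.
Qed.

Lemma pmin_le p i : pmin p <= p i 0.
Proof. exact: bigmin_le. Qed.

Lemma pmin_gt0 p : (forall i, 0 < p i 0) -> 0 < pmin p.
Proof. by move=> p0; apply/bigmin_gtP; split. Qed.

Lemma Lbar_ge (L : 'I_N -> R) i : L i <= Lbar L.
Proof. exact: le_bigmax. Qed.

Lemma Lbar_ge0 (L : 'I_N -> R) : 0 <= Lbar L.
Proof. by apply/bigmax_geP; left. Qed.

Lemma varpi_ge0 p : 'I_N -> 0 <= varpi p.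
Proof.
case=> n nN; rewrite addr_ge0 ?divr_ge0 ?sqr_ge0 // subr_ge0 ler1n.
exact: leq_trans nN.
Qed.

(* [c * ((i == l)%:R / p i 0 - 1)] is the deviation from the [p]-average of the
   vector whose only nonzero block, held by agent [l], is [c / p l 0]. *)
Lemma nnorm_injection_le p (c : R) (g : dsum H) : 0 <= c ->
    (forall i, 0 < p i 0 <= 1) ->
  nnorm (fun i l => (c * ((i == l)%:R / p i 0 - 1)) *: g l : H l)
    <= c * Num.sqrt (varpi p) * dnorm g.
Proof.
move=> c0 p01.
case: (pickP 'I_N) => [i0 _|N0]; last first.
  rewrite /nnorm /dnorm /l2 !big1 ?sqrtr0 ?mulr0 // => i _.
  - by have := N0 i.
  - by have := N0 i.
have varpi0 := varpi_ge0 p i0.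
rewrite -(@ler_pXn2r _ 2) ?nnegrE ?mulr_ge0 ?sqrtr_ge0 //.
rewrite sqr_nnorm !exprMn [Num.sqrt _ ^+ 2]sqr_sqrtr // exchange_big sqr_dnorm mulr_sumr.
rewrite ler_sum // => l _ /=.
have norm_sqr (a : R) : `|a *: g l| ^+ 2 = a ^+ 2 * `|g l| ^+ 2.
  by rewrite normrZ exprMn real_normK ?num_real.
under eq_bigr do rewrite norm_sqr exprMn.
rewrite -mulr_suml -mulr_sumr ler_wpM2r ?sqr_ge0 // ler_wpM2l ?sqr_ge0 //.
(* This is the origin of [varpi]: the [N - 1] agents other than [l] contribute 1 each, and agent [l]
   contributes [((p l 0)^-1 - 1) ^+ 2], largest at [pmin p]. *)
rewrite (bigD1 l) //= eqxx.
rewrite (eq_bigr (fun=> 1)) => [|i il]; last first.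
  by rewrite (negPf il) mul0r sub0r sqrrN expr1n.
rewrite sumr_const addrC; apply: lerD.
  rewrite (_ : #|_| = N.-1); last by rewrite cardC1 card_ord.
  have N_gt0 : (0 < N)%N by exact: leq_ltn_trans (ltn_ord l).
  by rewrite -subn1 natrB.
have [pl0 pl1] := andP (p01 l).
have m0 : 0 < pmin p by apply: pmin_gt0 => i; case/andP: (p01 i).
rewrite -expr_div_n lerXn2r ?nnegrE //.
- by rewrite mul1r subr_ge0 invf_ge1.
- by rewrite divr_ge0 ?(ltW m0) // subr_ge0 (le_trans (pmin_le p l)).
rewrite mulrBl mul1r mul1r divff ?gt_eqF // lerD2r lef_pV2 ?posrE //.
exact: pmin_le.
Qed.

End NetworkNorms.

(** * One step of the algorithm *)

Section DopIteration.
Context {R : realType} {N : nat} {H : 'I_N -> hilbertType R}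
  (Fi : forall i : 'I_N, dsum H -> H i) (A : 'M[R]_N) (p : 'cV[R]_N)
  (alpha : R) (x : nat -> 'I_N -> dsum H).
Hypotheses (A_stochastic : row_stochastic A) (p_stochastic : stochastic_vector p)
  (p_invariant : p^T *m A = p^T) (p_gt0 : forall i, 0 < p i 0)
  (x_dop : dop_iterates A p alpha Fi x).

Let A_sum1 i : \sum_j A i j = 1. Proof. by case: A_stochastic. Qed.
Let p_ge0 i : 0 <= p i 0. Proof. by case: p_stochastic. Qed.
Let p_sum1 : \sum_i p i 0 = 1. Proof. by case: p_stochastic. Qed.

Let p_le1 i : p i 0 <= 1.
Proof. by rewrite -p_sum1 (bigD1 i) //= lerDl sumr_ge0. Qed.

Definition deviation k i : dsum H := x k i - average p (x k).

(** Block [l] is the correction agent [l] makes to its own block, before the factor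
    [alpha / p l 0]. *)
Definition innovation k : dsum H :=
  fun l => Fi l (x k l) - \sum_j A l j *: x k j l.

Lemma dop_block k i l :
  x k.+1 i l = mix A (x k) i l + ((i == l)%:R * (alpha / p l 0)) *: innovation k l.
Proof.
have [xii xil] := x_dop k i.
have [<-|il] := eqVneq i l; first by rewrite mul1r xii.
by rewrite mul0r scale0r addr0 xil // eq_sym.
Qed.

(** Invariance of [p] makes mixing preserve the average, and the weight [p l 0] cancels the division
    in the step size. *)
Lemma average_dop k :
  average p (x k.+1) = average p (x k) + dscale alpha (innovation k).
Proof.
apply: functional_extensionality_dep => l; rewrite /average.
under eq_bigr do rewrite dop_block scalerDr scalerA.
rewrite big_split /= -scaler_suml; congr (_ + _).
  under eq_bigr do rewrite scaler_sumr.
  rewrite exchange_big /=; apply: eq_bigr => j _.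
  under eq_bigr do rewrite scalerA.
  by rewrite -scaler_suml (invariant_sum p_invariant).
congr (_ *: _); rewrite (bigD1 l) //= eqxx mul1r big1 ?addr0 => [|i il].
  by rewrite mulrC divfK ?gt_eqF.
by rewrite (negPf il) mul0r mulr0.
Qed.

(** The rows of [A - mean_mx p] sum to 0, so this matrix kills the common average and acts on
    deviations alone. *)
Lemma deviation_dop k : deviation k.+1 =
  (fun i => (mix (A - mean_mx p) (deviation k) i : dsum H)
    + (fun l => (alpha * ((i == l)%:R / p i 0 - 1)) *: innovation k l : H l)).
Proof.
apply: functional_extensionality_dep => i; apply: functional_extensionality_dep => l.
rewrite /deviation average_dop.
transitivity (mix A (x k) i l - average p (x k) l
  + ((i == l)%:R * (alpha / p l 0) - alpha) *: innovation k l).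
  rewrite -[LHS]/(x k.+1 i l - (average p (x k) l + alpha *: innovation k l)).
  by rewrite dop_block opprD addrACA scalerBl.
congr (_ + _ *: _); last first.
  have [->|_] := eqVneq i l; first by ring.
  by rewrite !mul0r; ring.
rewrite /mix; under [RHS]eq_bigr do rewrite scalerBr.
rewrite sumrB -scaler_suml.
have -> : \sum_m (A - mean_mx p) i m = 0.
  under eq_bigr do rewrite !mxE; rewrite sumrB A_sum1.
  by rewrite (eq_bigr (fun m => p m 0)) ?p_sum1 ?subrr // => m _; rewrite mxE.
rewrite scale0r subr0 -sumrB; apply: eq_bigr => m _.
by rewrite !mxE scalerBl.
Qed.

(** The difference is [u - v]: [u] is the cost of evaluating [Fi l] at agent [l]'s estimate and
    contributes [Lbar L]; [v] collects mixed deviations and contributes 1. *)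
Lemma innovation_residual_le L k : (forall i, 0 < L i) ->
    (forall i x y, `|Fi i x - Fi i y| <= L i * dnorm (x - y)) ->
  dnorm (innovation k - (joint Fi (average p (x k)) - average p (x k)))
    <= (Lbar L + 1) * nnorm (deviation k).
Proof.
move=> L0 FL.
pose u : dsum H := fun l => Fi l (x k l) - Fi l (average p (x k)).
pose v : dsum H := fun l => mix A (deviation k) l l.
have -> : innovation k - (joint Fi (average p (x k)) - average p (x k)) = u - v.
  apply: functional_extensionality_dep => l.
  rewrite -[LHS]/(innovation k l - (Fi l (average p (x k)) - average p (x k) l)).
  rewrite -[RHS]/(u l - v l) /v /mix.
  under [\sum_j _]eq_bigr do rewrite scalerBr.
  rewrite sumrB -scaler_suml A_sum1 scale1r /u /innovation opprB.
  by rewrite !opprB addrACA [- _ + _]addrC addrACA addrA.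
apply: le_trans (dnormD _ _) _; rewrite dnormN mulrDl mul1r; apply: lerD; last first.
  exact: mix_diag_le.
rewrite -l2Z ?Lbar_ge0 //; apply: (@l2_le _ _ (fun i => `|u i|)) => l.
rewrite normr_ge0; apply: le_trans (FL _ _ _) _.
by rewrite ler_wpM2r ?dnorm_ge0 // Lbar_ge.
Qed.

End DopIteration.

(** * Linear convergence of the agents' estimates *)

Theorem theorem2 (R : realType) (N : nat) (H : 'I_N -> hilbertType R)
    (Fi : forall i : 'I_N, dsum H -> H i)
    (g : rel 'I_N) (A : 'M[R]_N) (p : 'cV[R]_N)
    (L : 'I_N -> R) (kappa c1 c2 delta alpha : R) (alphaL : \bar R)
    (g_simple : irreflexive g)
    (g_connected : strongly_connected g)
    (A_stochastic : row_stochastic A)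
    (A_consistent : consistent g A)
    (A_diag : forall i, 0 < A i i)
    (p_stochastic : stochastic_vector p)
    (p_invariant : p^T *m A = p^T)
    (L_gt0 : forall i, 0 < L i)
    (Fi_lipschitz : forall i x y, `|Fi i x - Fi i y| <= L i * dnorm (x - y))
    (F_quasi_nonexpansive : quasi_nonexpansive (joint Fi))
    (F_fix : Fix (joint Fi) !=set0)
    (kappa_gt0 : 0 < kappa)
    (F_regular : forall x,
      distance (Fix (joint Fi)) x <= kappa * dnorm (joint Fi x - x))
    (c1_gt0 : 0 < c1) (c2_gt0 : 0 < c2)
    (c_equiv : norm_equiv_constants H p c1 c2)
    (delta01 : 0 < delta < 1)
    (alphaL_root : smallest_positive_root
      (fun a => \det (1%:M - Theta A p L c1 c2 kappa delta a)) alphaL)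
    (alpha_gt0 : 0 < alpha)
    (alpha_lt : (alpha%:E < Order.min (1 - delta)%:E alphaL)%E)
    (x : nat -> 'I_N -> dsum H)
    (x_dop : dop_iterates A p alpha Fi x) :
  exists xs : dsum H, Fix (joint Fi) xs /\
    exists C r : R, [/\ 0 < C, 0 < r < 1 &
      forall (i : 'I_N) (k : nat), dnorm (x k i - xs) <= C * r ^+ k].
Proof.
have [p_ge0 p_sum1] := p_stochastic.
have p_gt0 := invariant_gt0 g_connected A_stochastic A_consistent p_stochastic
  p_invariant.
have p_le1 i : p i 0 <= 1 by rewrite -p_sum1 (bigD1 i) //= lerDl sumr_ge0.
have p01 i : 0 < p i 0 <= 1 by rewrite p_gt0 p_le1.
have [i0 _|N0] := pickP 'I_N; last first.
  by have /eqP := p_sum1; rewrite big_pred0 // eq_sym oner_eq0.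
have varpi0 := varpi_ge0 p i0.
have rho1_1 : rho1 A p < 1 by exact: (rho1_lt1 g_connected).
have rho1_0 : 0 <= rho1 A p by exact: (rho1_ge0 g_connected).
have /andP[delta0 delta1] := delta01.
move: alpha_lt; rewrite lt_min lte_fin => /andP[alpha_delta alpha_root].
have [nnorm_equiv _ _] := c_equiv.
have L1 : 0 < Lbar L + 1 by rewrite ltr_wpDl // Lbar_ge0.
(* [q], [th] and [B] are the coefficients of the determinant in [det_sub_Theta]. *)
pose q := delta / (4 * kappa ^+ 2).
have q0 : 0 < q by rewrite divr_gt0 ?mulr_gt0 ?exprn_gt0.
pose th := theta5 p L c1 c2.
have th0 : 0 <= th by rewrite divr_ge0 ?mulr_ge0 ?sqrtr_ge0 // ltW.
pose B := 2 * c2 * Num.sqrt (2 * varpi p) * ((Lbar L + 1) / c1).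
have B0 : 0 <= B.
  by rewrite !mulr_ge0 ?sqrtr_ge0 ?invr_ge0 ?(ltW L1) ?(ltW c1_gt0) ?(ltW c2_gt0).
have det_gt0 : 0 < (1 - rho1 A p) * q - alpha * (th * q + B).
  apply: smallest_positive_root_gt0 alphaL_root alpha_gt0 alpha_root.
  - by move=> a; exact: det_sub_Theta.
  - by rewrite mulr_gt0 // subr_gt0.
  - by apply: addr_ge0 => //; apply: mulr_ge0 => //; exact: ltW.
pose e k := nnorm_w p (deviation p x k).
pose d k := distance (Fix (joint Fi)) (average p (x k)).
have e0 k : 0 <= e k by exact: wl2_ge0.
have d0 k : 0 <= d k by exact: distance_ge0.
have dev_le k : nnorm (deviation p x k) <= e k / c1.
  by rewrite ler_pdivlMr // mulrC; case/andP: (nnorm_equiv (deviation p x k)).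
have residual k : dnorm (joint Fi (average p (x k)) - average p (x k)) <= 2 * d k.
  exact: residual_le_distance.
have error k : dnorm (innovation Fi A x k
    - (joint Fi (average p (x k)) - average p (x k))) <= (Lbar L + 1) / c1 * e k.
  apply: le_trans (innovation_residual_le p x A_stochastic k L_gt0 Fi_lipschitz) _.
  by rewrite mulrAC -mulrA ler_wpM2l ?(ltW L1).
have innov k : dnorm (innovation Fi A x k) <= 2 * d k + (Lbar L + 1) / c1 * e k.
  rewrite -[innovation _ _ _ _](subrK (joint Fi (average p (x k)) - average p (x k))).
  by rewrite addrC; apply: le_trans (dnormD _ _) _; exact: lerD.
(* First row of [Theta alpha]: mixing contracts by [rho1], and the injected innovation is bounded
   through [innov]. *)
have eS k : e k.+1 <= (rho1 A p + alpha * th) * e k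
    + 2 * alpha * c2 * Num.sqrt (2 * varpi p) * d k.
  rewrite /e (deviation_dop A_stochastic p_stochastic p_invariant p_gt0 x_dop).
  apply: le_trans (nnorm_wD _ _ p_ge0) _; rewrite mulrDl -addrA; apply: lerD.
    rewrite -(AinftyE g_connected A_stochastic) //.
    apply: nnorm_w_mix_le => // z.
    exact: (le_rho1 g_connected).
  have [_ /le_trans le_c2] := andP (nnorm_equiv (fun i l =>
    (alpha * ((i == l)%:R / p i 0 - 1)) *: innovation Fi A x k l)).
  apply: le_c2.
  have := nnorm_injection_le (innovation Fi A x k) (ltW alpha_gt0) p01.
  move/(ler_wpM2l (ltW c2_gt0))/le_trans; apply.
  (* [sL] and [s2] enlarge the coefficients obtained to those written in [Theta]. *)
  have sL : Lbar L + 1 <= 2 * Num.sqrt (Lbar L ^+ 2 + 1).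
    have S0 : 0 <= Lbar L ^+ 2 + 1 by rewrite addr_ge0 ?sqr_ge0.
    rewrite -(@ler_pXn2r _ 2) ?nnegrE ?mulr_ge0 ?sqrtr_ge0 ?(ltW L1) //.
    rewrite exprMn sqr_sqrtr //; have := sqr_ge0 (Lbar L - 1); nra.
  have s2 : 2 <= 2 * Num.sqrt 2 :> R.
    by rewrite ler_peMr // -[leLHS]sqrtr1 ler_wsqrtr // ler1n.
  have -> : alpha * th * e k + 2 * alpha * c2 * Num.sqrt (2 * varpi p) * d k
    = c2 * (alpha * Num.sqrt (varpi p) * (2 * Num.sqrt 2 * d k
        + 2 * Num.sqrt (Lbar L ^+ 2 + 1) / c1 * e k)).
    by rewrite /th /theta5 !sqrtrM //; ring.
  rewrite ler_pM2l // ler_wpM2l ?mulr_ge0 ?sqrtr_ge0 ?(ltW alpha_gt0) //.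
  apply: le_trans (innov k) _; apply: lerD; rewrite ler_wpM2r //.
  by rewrite ler_pM2r ?invr_gt0.
have avgS := average_dop p_invariant p_gt0 x_dop.
(* Second row of [Theta alpha]: the new average is a relaxed step from [xb] plus [alpha] times the
   error of the innovation. *)
have dS k : d k.+1 <= alpha * (Lbar L + 1) / c1 * e k + (1 - q * alpha) * d k.
  rewrite /d; set xb := average p (x k).
  have -> : average p (x k.+1) = (xb + dscale alpha (joint Fi xb - xb))
      + dscale alpha (innovation Fi A x k - (joint Fi xb - xb)).
    rewrite avgS -addrA; congr (_ + _).
    apply: functional_extensionality_dep => l.
    rewrite -[RHS]/(alpha *: (joint Fi xb - xb) l
      + alpha *: (innovation Fi A x k l - (joint Fi xb - xb) l)).
    by rewrite -scalerDr addrC subrK.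
  apply: le_trans (distanceD _ _ F_fix) _; rewrite addrC; apply: lerD.
    rewrite dnormZ ?(ltW alpha_gt0) // -!mulrA ler_pM2l // mulrA; exact: error.
  have -> : q * alpha = delta * alpha / (4 * kappa ^+ 2) by rewrite /q mulrAC.
  exact: distance_relaxed.
(* Adding [alpha * B >= 0] to the positive bracket [det_gt0] leaves
   [(1 - (rho1 A p + alpha * th)) * q]. *)
have s1 : rho1 A p + alpha * th < 1.
  have : 0 < (1 - (rho1 A p + alpha * th)) * q.
    have := mulr_ge0 (ltW alpha_gt0) B0; set b := alpha * B => b0.
    have : 0 < (1 - (rho1 A p + alpha * th)) * q - b by rewrite /b; lra.
    lra.
  by rewrite pmulr_lgt0 // subr_gt0.
have t1 : 1 - q * alpha < 1 by rewrite gtrBl mulr_gt0.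
have b0 : 0 <= 2 * alpha * c2 * Num.sqrt (2 * varpi p).
  by rewrite !mulr_ge0 ?sqrtr_ge0 ?(ltW alpha_gt0) ?(ltW c2_gt0).
have c0 : 0 < alpha * (Lbar L + 1) / c1 by rewrite divr_gt0 ?mulr_gt0.
(* Positivity of the determinant, rearranged. *)
have bc : 2 * alpha * c2 * Num.sqrt (2 * varpi p) * (alpha * (Lbar L + 1) / c1)
    < (1 - (rho1 A p + alpha * th)) * (1 - (1 - q * alpha)).
  have := mulr_gt0 alpha_gt0 det_gt0; rewrite /B -subr_gt0 => h.
  by rewrite -subr_gt0; move: h; congr (_ < _); ring.
have [C [r [C0 r01 ed_le]]] := coupled_linear_rate e0 d0 s1 t1 b0 c0 bc eS dS.
have /andP[r0 r1] := r01.
have rk0 k : 0 <= r ^+ k by rewrite exprn_ge0 // ltW.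
pose K := 2 * C + (Lbar L + 1) / c1 * C.
have Lc0 : 0 <= (Lbar L + 1) / c1 by rewrite divr_ge0 // ltW.
have K0 : 0 <= K by apply: addr_ge0; apply: mulr_ge0.
have step_le k : dnorm (average p (x k.+1) - average p (x k)) <= alpha * K * r ^+ k.
  rewrite avgS [X in dnorm (X - _)]addrC addrK dnormZ ?(ltW alpha_gt0) //.
  rewrite -mulrA ler_pM2l //.
  apply: le_trans (innov k) _; have [ek dk] := ed_le k.
  rewrite (_ : K * _ = 2 * (C * r ^+ k) + (Lbar L + 1) / c1 * (C * r ^+ k)).
    by apply: lerD; rewrite ler_wpM2l.
  by rewrite /K; ring.
have [|xs [K' K'0 xs_le]] := dnorm_geometric_limit _ r01 step_le.
  by rewrite mulr_ge0 // ltW.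
exists xs; split.
  apply: functional_extensionality_dep => i; apply/eqP; rewrite -subr_eq0 -normr_le0.
  (* The norm of block [i] of the residual at [xs] does not depend on [k]; split through [xb], it is
     bounded by three terms of order [r ^+ k], hence it is 0. *)
  apply: (@le0_of_le_geometric _ _ (L i * K' + 2 * C + K') r) => // k.
  set xb := average p (x k).
  have -> : joint Fi xs i - xs i =
      (Fi i xs - Fi i xb) + (joint Fi xb - xb) i + (xb - xs) i.
    rewrite -[(joint Fi xb - xb) i]/(Fi i xb - xb i) -[(xb - xs) i]/(xb i - xs i).
    by rewrite !subrKA.
  apply: le_trans (ler_normD _ _) _; rewrite mulrDl; apply: lerD; last first.
    by apply: le_trans (xs_le k); exact: ler_dnorm.
  apply: le_trans (ler_normD _ _) _; rewrite mulrDl; apply: lerD.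
    apply: le_trans (Fi_lipschitz _ _ _) _; rewrite -mulrA ler_pM2l //.
    by rewrite dnormBC; exact: xs_le.
  apply: le_trans (ler_dnorm _ _) _; apply: le_trans (residual k) _.
  by rewrite -mulrA ler_pM2l //; case: (ed_le k).
(* [C / c1] covers the deviation, [K'] the average, and 1 makes the constant positive. *)
exists (C / c1 + K' + 1), r; split=> // [|i k].
  by rewrite ltr_wpDl // addr_ge0 // divr_ge0 // ltW.
apply: le_trans (dnorm_triangle (average p (x k)) _ _) _.
rewrite !mulrDl mul1r -[leLHS]addr0; apply: lerD => //; apply: lerD => //.
apply: le_trans (_ : nnorm (deviation p x k) <= _).
  exact: (@ler_l2 _ _ (fun i => dnorm (deviation p x k i)) i (dnorm_ge0 _)).
apply: le_trans (dev_le k) _; rewrite mulrAC ler_pM2r ?invr_gt0 //.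
by case: (ed_le k).
Qed.
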